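(* For every real $\ell>0$ there is a number $\theta_0=\theta_0(\ell)\in(0,1)$, depending on $\ell$, with the following property. Suppose $(x_{n})_{n\in\mathbb{Z}}$ is a strictly increasing sequence of real numbers without accumulation point in $\mathbb{R}$, with $x_0=0$, and $(b_{n})_{n\in\mathbb{Z}}$ is an associated sequence of positive numbers. Put $a_n=x_n-x_{n-1}$ and suppose that $$\sup_{n\in\mathbb{Z}} \left(\frac{\max(b_{n-1},b_{n+1})}{\min(a_n,a_{n+1})}\right) = \ell .$$ Then for any $p>0$, if $$\sum_{j=1}^\infty \Big(\max_{|n| \leq j} a_n^2\Big)\, \theta_0^{j/p} < \infty,$$ then $E(\tau_{\mathscr{M}_{x}}^p)<\infty$.
   Context: Given an increasing sequence $(x_{n})_{n\in\mathbb{Z}}$ of distinct real numbers without accumulation point in $\mathbb{R}$ and positive numbers $(b_{n})_{n\in\mathbb{Z}}$, the comb domain is $\mathscr{M}_{x}:=\mathbb{C}\setminus\bigcup_{n\in\mathbb{Z}}I_{n}$, where $I_{n}:=\{x_{n}\}\times([b_n,+\infty)\cup(-\infty,-b_n])$ (identifying $\mathbb{C}$ with $\mathbb{R}^2$). For a domain $\Omega\subset\mathbb{C}$, $\tau_\Omega$ denotes the first exit time from $\Omega$ of a standard planar Brownian motion $Z_t$ started at a point of $\Omega$. Finiteness of $E(\tau_\Omega^p)$ does not depend on the starting point in $\Omega$ (a known fact due to Burkholder), so one writes $E(\tau_\Omega^p)<\infty$ without specifying it. *)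

(* Defs.v *)
From HB Require Import structures.
From mathcomp Require Import all_boot all_order all_algebra.
From mathcomp Require Import all_classical all_reals all_analysis.
Set Implicit Arguments.
Unset Strict Implicit.
Unset Printing Implicit Defensive.
Import Order.TTheory GRing.Theory Num.Theory.
Import numFieldNormedType.Exports.
Local Open Scope classical_set_scope.
Local Open Scope ring_scope.

(* The complex plane is identified with R * R throughout. *)

Section comb.
Context {R : realType}.
Implicit Types x b : int -> R.

Definition comb_slit x b (n : int) : set (R * R) :=
  [set x n] `*` (`[b n, +oo[ `|` `]-oo, - b n]).

Definition comb_domain x b : set (R * R) :=
  ~` \bigcup_(n in [set: int]) comb_slit x b n.

Definition gap x (n : int) : R := x n - x (n - 1).

(* The maximum of gap x n ^+ 2 over the integers n with `|n| <= j; the default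
   value 0 is harmless because the terms are nonnegative. *)
Definition max_gap_sq x (j : nat) : R :=
  \big[Num.max/0]_(k < j.+1)
     Num.max (gap x k%:Z ^+ 2) (gap x (- k%:Z) ^+ 2).

Definition gap_ratio x b (n : int) : R :=
  Num.max (b (n - 1)) (b (n + 1)) / Num.min (gap x n) (gap x (n + 1)).

End comb.

Section brownian.
Context {R : realType} {d : measure_display} {T : measurableType d}.
Variable P : probability T R.

(* Letting some A i be setT gives the product rule for all subfamilies. *)
Definition mutually_independent {d' : measure_display}
    {T' : measurableType d'} (n : nat) (X : 'I_n -> T -> T') : Prop :=
  forall A : 'I_n -> set T', (forall i, measurable (A i)) ->
    P (\bigcap_(i in [set: 'I_n]) (X i @^-1` A i)) =
    (\prod_(i < n) P (X i @^-1` A i))%E.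

Definition increment (Z : R -> T -> R * R) (s t : R) : T -> R * R :=
  fun w => Z t w - Z s w.

(* The time set is [0, +oo[; values of Z at negative times are unconstrained.
   Every path is required to be continuous and to start at z, so that the exit
   time from an open set is measurable. The second parameter of normal_prob is
   the standard deviation. *)
Record standard_planar_BM (z : R * R) (Z : R -> T -> R * R) : Prop := {
  BM_measurable : forall t, 0 <= t -> measurable_fun [set: T] (Z t) ;
  BM_start : forall w, Z 0 w = z ;
  BM_continuous :
    forall w, {within `[0, +oo[, continuous (fun t : R => Z t w)} ;
  BM_gaussian : forall s t, 0 <= s -> s < t ->
    forall A : set (R * R), measurable A ->
      pushforward P (increment Z s t) A =
      (normal_prob 0 (Num.sqrt (t - s)) \x
       normal_prob 0 (Num.sqrt (t - s)))%E A ;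
  BM_independent : forall (n : nat) (t : nat -> R),
    0 <= t 0%N -> nondecreasing_seq t ->
    mutually_independent (fun i : 'I_n => increment Z (t i) (t i.+1)) }.

(* Equal to +oo on the paths that never leave D. *)
Definition exit_time (Z : R -> T -> R * R) (D : set (R * R)) (w : T) : \bar R :=
  ereal_inf [set t%:E | t in [set t : R | 0 <= t /\ ~ D (Z t w)]].

(* The expectation of the p-th power of an extended-real random time. *)
Definition moment (tau : T -> \bar R) (p : R) : \bar R :=
  (\int[P]_w (tau w `^ p))%E.

End brownian.

(* Finiteness of E(tau_D ^ p), whatever the starting point in D and whatever
   the probability space carrying the Brownian motion. *)
Definition finite_exit_moment {R : realType} (D : set (R * R)) (p : R) : Prop :=
  forall (d : measure_display) (T : measurableType d) (P : probability T R)
         (z : R * R) (Z : R -> T -> R * R),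
    D z -> standard_planar_BM P z Z ->
    (moment P (exit_time Z D) p < +oo)%E.

(* Main.v *)
(* Call the line {x_n} x R the gate n and its complementary interval in the comb the
   hole n. A Lyapunov function V for the Brownian motion killed on the slits |n| < J
   is the minimum, over the gates n neighbouring the current
   position, of growth^|n| (1 - barrier / 2 - small quadratic term). The barrier is
   subharmonic, bounded, at least 1/K along the gate n and at most 0 in the two
   neighbouring holes, whose sizes the ratio bound controls. As growth > 1 is chosen
   with growth (1 - 1/(2K)) < 1, in the hole n + 1 or n - 1 the minimum is attained by
   the function of that gate and no longer by that of the gate n, so V is
   superharmonic across the holes; the quadratic term makes it decrease at a rate
   proportional to 1 / M_J, where M_J = max_{|n| <= J} a_n^2. Since V is of order
   growth^J once the gates |n| < J are left, P(tau > t_J) <= C growth^(-J) for some t_J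
   of order J M_J, and E(tau^p) is at most a constant times the sum of
   t_(J+1)^p growth^(-J). The hypothesis with theta_0 = growth^(-1/2) bounds M_J^p by a
   constant times growth^(J/2), so that this sum converges.

   The Brownian motion is only used at the times k t / N: a Gaussian increment is
   averaged over the eight symmetries of the square, and by uniform continuity a
   path surviving until t crosses each gate in or very near its hole once N is
   large. *)
From HB Require Import structures.
Require Import Defs.
From mathcomp Require Import all_boot all_order all_algebra.
From mathcomp Require Import all_classical all_reals all_analysis.
From mathcomp Require Import measurable_realfun ring lra zify.
Set Implicit Arguments.
Unset Strict Implicit.
Unset Printing Implicit Defensive.
Import Order.TTheory GRing.Theory Num.Theory.
Import numFieldNormedType.Exports.
Local Open Scope classical_set_scope.
Local Open Scope ring_scope.

(** * The barrier *)

Section cosh_bounds.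
Context {R : realType}.
Implicit Types u : R.

Lemma expR_le_inv1B u : u < 1 -> expR u <= (1 - u)^-1.
Proof.
move=> u1; rewrite -[expR u]invrK -expRN lef_pV2 ?posrE ?expR_gt0 ?subr_gt0//.
exact: expR_ge1Dx.
Qed.

(** Adding [expR v <= 1 / (1 - v)] for [v = u] and [v = - u] gives [2 / (1 - u ^+ 2)]. *)
Lemma cosh_ub u : `|u| <= 1 / 2 -> expR u + expR (- u) <= 2 + 3 * u ^+ 2.
Proof.
move=> /ler_normlP[u1 u2].
have h1 : expR u * (1 - u) <= 1.
  rewrite -ler_pdivlMr; last lra.
  by rewrite div1r expR_le_inv1B//; lra.
have h2 : expR (- u) * (1 + u) <= 1.
  rewrite -ler_pdivlMr; last lra.
  have := @expR_le_inv1B (- u); rewrite opprK div1r; apply; lra.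
have ep := expR_gt0 u; have en := expR_gt0 (- u).
have h3 : (expR u + expR (- u)) * (1 - u ^+ 2) <= 2 by nra.
have u4 : u ^+ 2 <= 1 / 4 by nra.
have u0 := sqr_ge0 u.
have k : 2 <= (2 + 3 * u ^+ 2) * (1 - u ^+ 2) by nra.
have : (expR u + expR (- u)) * (1 - u ^+ 2) <= (2 + 3 * u ^+ 2) * (1 - u ^+ 2).
  exact: le_trans h3 k.
by rewrite ler_pM2r//; lra.
Qed.

(** Squaring [1 + v / 2 <= expR (v / 2)] for [v = u] and [v = - u]; this gives half of the true
    quadratic coefficient, which suffices below. *)
Lemma cosh_lb u : `|u| <= 1 -> 2 + u ^+ 2 / 2 <= expR u + expR (- u).
Proof.
move=> /ler_normlP[u1 u2].
have sq (v : R) : expR v = expR (v / 2) ^+ 2.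
  by rewrite -expRM_natl; congr expR; field.
have h (v : R) : `|v| <= 1 -> (1 + v / 2) ^+ 2 <= expR v.
  move=> /ler_normlP[v1 v2]; rewrite sq lerXn2r// ?nnegrE ?expR_ge0 ?expR_ge1Dx//; lra.
have := h u; have := h (- u); rewrite normrN.
move=> /(_ ltac:(by apply/ler_normlP; split; lra)) k1.
move=> /(_ ltac:(by apply/ler_normlP; split; lra)) k2.
nra.
Qed.

End cosh_bounds.

(** * Discretely subharmonic bumps *)

Section barrier.
Context {R : realType} (l : R).

(** The orbit of [(a, b)] under the symmetries of the square. The sign changes cancel the odd terms
    of a Taylor expansion, and the exchange of [a] and [b] turns the second-order ones into a
    multiple of the Laplacian, so that [8 * F 0 0 <= sum8 F a b] is a discrete subharmonicity. *)
Definition sum8 (F : R -> R -> R) (a b : R) : R :=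
  F a b + F (- a) b + F a (- b) + F (- a) (- b) +
  F b a + F (- b) a + F b (- a) + F (- b) (- a).

(* The gate is at abscissa 0 and its nearer neighbour at abscissa -1, with holes of
   half-height at most l. The center bump makes the barrier positive on the low part
   of the gate, the slit bumps for s = 1 and s = -1 on its upper and lower parts. *)
Definition bump_height : R := l + 125.
Definition bump_scale : R := 32 * expR (6 * (bump_height + 1)).

Definition center_bump (X Y : R) : R :=
  (1 - X ^+ 2) * (1 - 4 * X ^+ 2) * (expR (6 * Y) + expR (- (6 * Y)))
  / bump_scale.

Definition slit_bump (s X Y : R) : R :=
  1 / 2 * (3 / 4 - X)
  - 2 * (1 - X ^+ 2 / 4) * expR ((l + 1 - s * Y) / 4).

Lemma bump_scale_gt0 : 0 < bump_scale.
Proof. by rewrite /bump_scale mulr_gt0 ?expR_gt0. Qed.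

(** Completing the square. With [x = X ^+ 2], the coefficient of [a ^+ 2 + b ^+ 2] in the
    eight-point sum of the center bump is [36 * Q + 96 * x - 20], if [cosh_lb] is used for the
    exponentials. *)
Lemma bump_poly_aux1 (x : R) : 0 <= x ->
  23 <= 36 * ((1 - x) * (1 - 4 * x)) + 96 * x.
Proof.
move=> x0.
have : 0 <= (12 * x - 7 / 2) ^+ 2 by exact: sqr_ge0.
rewrite (_ : _ ^+ 2 = 144 * x ^+ 2 - 84 * x + 49 / 4); last by field.
rewrite (_ : _ + 96 * x = 144 * x ^+ 2 - 84 * x + 36); last by ring.
lra.
Qed.

(** Half of the eight-point sum: [c] is the squared step in [X], [D] the one in [Y], and [C] the
    hyperbolic cosine factor. Besides non-negative products, expanding in [C - 2] leaves only
    [- 10 * c * (C - 2)], where [C - 2 <= 108 / 400 = 27 / 100]. *)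
Lemma bump_poly_aux2 (Q x c C D : R) : 0 <= Q -> 0 <= x ->
  0 <= c -> 0 <= D -> D <= 1 / 20 * (1 / 20) -> 2 + 18 * D <= C -> C <= 2 + 108 * D ->
  4 * Q + 36 * Q * D + 4 * (-5 + 24 * x) * c - 10 * c * (27 / 100) <=
  (2 * Q + 2 * ((- 5 + 24 * x) * c + 4 * c ^+ 2)) * C.
Proof.
move=> Q0 x0 c0 D0 D1 C1 C2.
have d1 : 0 <= C - 2 - 18 * D by lra.
have d2 : 0 <= C - 2 by lra.
have d3 : 0 <= C by lra.
have d4 : C - 2 <= 27 / 100 by lra.
have t1 : 0 <= Q * (C - 2 - 18 * D) by rewrite mulr_ge0.
have t2 : 0 <= c * x * (C - 2) by rewrite !mulr_ge0.
have t3 : 0 <= c ^+ 2 * C by rewrite mulr_ge0 ?sqr_ge0.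
have t4 : c * (C - 2) <= c * (27 / 100) by rewrite ler_wpM2l.
have -> : (2 * Q + 2 * ((- 5 + 24 * x) * c + 4 * c ^+ 2)) * C =
   4 * Q + 36 * Q * D + 4 * (-5 + 24 * x) * c + 2 * (Q * (C - 2 - 18 * D))
   - 10 * (c * (C - 2)) + 48 * (c * x * (C - 2)) + 8 * (c ^+ 2 * C) by ring.
clear - t1 t2 t3 t4; lra.
Qed.

Lemma bump_poly_aux3 (Q x A B Ca Cb : R) :
  0 <= A -> A <= 1 / 20 * (1 / 20) -> 0 <= B -> B <= 1 / 20 * (1 / 20) ->
  0 <= Q -> 0 <= x ->
  23 <= 36 * Q + 96 * x ->
  2 + 18 * A <= Ca -> Ca <= 2 + 108 * A ->
  2 + 18 * B <= Cb -> Cb <= 2 + 108 * B ->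
  8 * Q <= (2 * Q + 2 * ((- 5 + 24 * x) * A + 4 * A ^+ 2)) * Cb +
           (2 * Q + 2 * ((- 5 + 24 * x) * B + 4 * B ^+ 2)) * Ca.
Proof.
move=> A0 A1 B0 B1 Q0 x0 q1 ca1 ca2 cb1 cb2.
have k1 := bump_poly_aux2 Q0 x0 A0 B0 B1 cb1 cb2.
have k2 := bump_poly_aux2 Q0 x0 B0 A0 A1 ca1 ca2.
(* The first factor is at least [23 - 20 - 27 / 10], which is positive. *)
have k3 : 0 <= (36 * Q + 4 * (-5 + 24 * x) - 27 / 10) * (A + B).
  by rewrite mulr_ge0; lra.
have {}k3 : 0 <= 36 * Q * A + 36 * Q * B + 4 * (-5 + 24 * x) * A
    + 4 * (-5 + 24 * x) * B - 27 / 10 * A - 27 / 10 * B.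
  by move: k3; rewrite (_ : _ * (A + B) = 36 * Q * A + 36 * Q * B + 4 * (-5 + 24 * x) * A
    + 4 * (-5 + 24 * x) * B - 27 / 10 * A - 27 / 10 * B)//; ring.
move: k1 k2 k3; clear.
set X1 := (2 * Q + _) * _; set X2 := (2 * Q + _) * _.
lra.
Qed.

Lemma sum8_center_bump (X Y a b : R) :
  `|X| <= 1 / 2 -> `|a| <= 1 / 20 -> `|b| <= 1 / 20 ->
  8 * center_bump X Y <= sum8 (fun a b => center_bump (X + a) (Y + b)) a b.
Proof.
move=> hX ha hb; rewrite /center_bump /sum8.
rewrite !mulrA -!mulrDl ler_pM2r ?invr_gt0 ?bump_scale_gt0//.
have E c : expR (6 * (Y + c)) = expR (6 * Y) * expR (6 * c) by rewrite -expRD mulrDr.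
have E' c : expR (- (6 * (Y + c))) = expR (- (6 * Y)) * expR (- (6 * c)).
  by rewrite -expRD mulrDr opprD.
rewrite !{}E !{}E' !mulrN !opprK.
have [ca1 ca2] : 2 + 18 * a ^+ 2 <= expR (6 * a) + expR (- (6 * a)) /\
   expR (6 * a) + expR (- (6 * a)) <= 2 + 108 * a ^+ 2.
  have h : `|6 * a| <= 1 / 2 by move: ha; rewrite !ler_norml => /andP[? ?]; lra.
  split.
    by have := @cosh_lb _ (6 * a) ltac:(lra); rewrite exprMn; lra.
  by have := @cosh_ub _ (6 * a) h; rewrite exprMn; lra.
have [cb1 cb2] : 2 + 18 * b ^+ 2 <= expR (6 * b) + expR (- (6 * b)) /\
   expR (6 * b) + expR (- (6 * b)) <= 2 + 108 * b ^+ 2.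
  have h : `|6 * b| <= 1 / 2 by move: hb; rewrite !ler_norml => /andP[? ?]; lra.
  split.
    by have := @cosh_lb _ (6 * b) ltac:(lra); rewrite exprMn; lra.
  by have := @cosh_ub _ (6 * b) h; rewrite exprMn; lra.
set Ca := expR (6 * a) + expR (- (6 * a)) in ca1 ca2.
set Cb := expR (6 * b) + expR (- (6 * b)) in cb1 cb2.
set G := expR (6 * Y) + expR (- (6 * Y)).
have G0 : 0 < G by rewrite addr_gt0 ?expR_gt0.
pose q x : R := (1 - x ^+ 2) * (1 - 4 * x ^+ 2).
(* The addition formula for the exponentials lets the common factor [G] be divided out. *)
suff H : 8 * q X <= (q (X + a) + q (X - a)) * Cb + (q (X + b) + q (X - b)) * Ca.
  rewrite [leLHS](_ : _ = 8 * q X * G); last by rewrite /q; ring.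
  rewrite [leRHS](_ : _ = ((q (X + a) + q (X - a)) * Cb +
    (q (X + b) + q (X - b)) * Ca) * G); last by rewrite /q /Ca /Cb /G; ring.
  by rewrite ler_wpM2r// ltW.
move: hX ha hb; rewrite !ler_norml => /andP[x1 x2] /andP[a1 a2] /andP[b1 b2].
have X2 : X ^+ 2 <= 1 / 4 by nra.
have A2 : a ^+ 2 <= 1 / 20 * (1 / 20) by nra.
have B2 : b ^+ 2 <= 1 / 20 * (1 / 20) by nra.
have q0 : 0 <= q X by rewrite /q mulr_ge0; lra.
have qs c : q (X + c) + q (X - c) =
    2 * q X + 2 * ((- 5 + 24 * X ^+ 2) * c ^+ 2 + 4 * (c ^+ 2) ^+ 2).
  by rewrite /q; ring.
rewrite !qs; apply: bump_poly_aux3 => //; rewrite ?sqr_ge0//.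
by rewrite /q bump_poly_aux1 ?sqr_ge0.
Qed.

Lemma slit_poly_aux (g A B Ca Cb : R) : 1 / 4 <= g -> g <= 1 ->
  0 <= A -> A <= 1 -> 0 <= B -> B <= 1 ->
  Ca <= 2 + 3 / 16 * A -> Cb <= 2 + 3 / 16 * B ->
  (2 * g - A / 2) * Cb + (2 * g - B / 2) * Ca <= 8 * g.
Proof.
move=> g0 g1 A0 A1 B0 B1 ca cb.
have hA : 0 <= 2 * g - A / 2 by lra.
have hB : 0 <= 2 * g - B / 2 by lra.
have k1 := ler_wpM2l hA cb; have k2 := ler_wpM2l hB ca.
have k3 : g * A <= A by rewrite ler_piMl.
have k4 : g * B <= B by rewrite ler_piMl.
have k5 : 0 <= A * B by rewrite mulr_ge0.
have e1 : (2 * g - A / 2) * (2 + 3 / 16 * B) =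
  4 * g - A + 3 / 8 * (g * B) - 3 / 32 * (A * B) by field.
have e2 : (2 * g - B / 2) * (2 + 3 / 16 * A) =
  4 * g - B + 3 / 8 * (g * A) - 3 / 32 * (A * B) by field.
rewrite e1 in k1; rewrite e2 in k2.
move: k1 k2; set u := _ * Cb; set v := _ * Ca => k1 k2.
clear - k1 k2 k3 k4 k5 A0 B0; lra.
Qed.

(** Averaging preserves the affine part. The subtracted product is superharmonic, because the second
    derivative [- 1 / 2] of [1 - X ^+ 2 / 4] outweighs the factor [1 / 16] coming from the
    exponential. *)
Lemma sum8_slit_bump (s X Y a b : R) : s ^+ 2 = 1 ->
  `|X| <= 1 -> `|a| <= 1 / 20 -> `|b| <= 1 / 20 ->
  8 * slit_bump s X Y <= sum8 (fun a b => slit_bump s (X + a) (Y + b)) a b.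
Proof.
move=> s1 hX ha hb.
have cosh_le c : `|c| <= 1 / 20 ->
    expR (- (s * c / 4)) + expR (s * c / 4) <= 2 + 3 / 16 * c ^+ 2.
  move=> hc; rewrite addrC; apply: le_trans (cosh_ub _) _.
    have s1' : `|s| = 1.
      by apply/eqP; rewrite -(@eqrXn2 _ 2)// real_normK ?num_real// s1 expr1n.
    by rewrite !normrM s1' mul1r [`|4^-1|]ger0_norm ?invr_ge0//; lra.
  by rewrite !exprMn s1; lra.
have ca := cosh_le _ ha; have cb := cosh_le _ hb.
set Ca := (X in X <= _) in ca; set Cb := (X in X <= _) in cb.
rewrite /sum8 /slit_bump.
set E := expR ((l + 1 - s * Y) / 4).
have E0 : 0 < E by rewrite expR_gt0.
have Ee c : expR ((l + 1 - s * (Y + c)) / 4) = E * expR (- (s * c / 4)).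
  by rewrite -expRD; congr expR; field.
have [X2 A1 B1] : [/\ X ^+ 2 <= 1, a ^+ 2 <= 1 & b ^+ 2 <= 1].
  have sq_le1 (c : R) : `|c| <= 1 -> c ^+ 2 <= 1.
    by move=> c1; rewrite -real_normK ?num_real// expr_le1.
  by split; apply: sq_le1 => //; lra.
have H : 2 * ((2 * (1 - X ^+ 2 / 4) - a ^+ 2 / 2) * Cb +
    (2 * (1 - X ^+ 2 / 4) - b ^+ 2 / 2) * Ca) * E <=
    2 * (8 * (1 - X ^+ 2 / 4)) * E.
  rewrite ler_wpM2r ?(ltW E0)// ler_wpM2l//.
  have := sqr_ge0 X.
  by move=> X0; apply: slit_poly_aux => //; rewrite ?sqr_ge0//; lra.
have Ne c : E * expR (- (s * - c / 4)) = E * expR (s * c / 4).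
  by rewrite mulrN mulNr opprK.
rewrite !Ee (Ne a) (Ne b).
have pair c k : 1 / 2 * (3 / 4 - (X + c)) - 2 * (1 - (X + c) ^+ 2 / 4) * (E * k)
    + (1 / 2 * (3 / 4 - (X - c)) - 2 * (1 - (X - c) ^+ 2 / 4) * (E * k)) =
    (3 / 4 - X) - 2 * ((2 * (1 - X ^+ 2 / 4) - c ^+ 2 / 2) * k * E) by field.
have pa1 := pair a (expR (- (s * b / 4))).
have pa2 := pair a (expR (s * b / 4)).
have pb1 := pair b (expR (- (s * a / 4))).
have pb2 := pair b (expR (s * a / 4)).
move: pa1 pa2 pb1 pb2 H; rewrite /Ca /Cb !mulrDr !mulrDl; clear.
lra.
Qed.

End barrier.

(** * Gluing the bumps into a bounded barrier *)

Section barrier_function.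
Context {R : realType} (l : R).
Hypothesis l0 : 0 < l.

Local Notation H := (bump_height l).
Local Notation K := (bump_scale l).

(** The slit bumps are cut at [X = 1], being already non-positive from [3 / 4] on. The center bump
    is cut at [|X| = 1 / 2], where it changes sign, and at [|Y| = H], just above which a slit bump
    dominates it. *)
Definition barrier (X Y : R) : R :=
  Num.max 0 (Num.max
    (if (`|X| <= 1 / 2) && (`|Y| <= H) then center_bump l X Y else 0)
    (if X <= 1 then Num.max (slit_bump l 1 X Y) (slit_bump l (- 1) X Y) else 0)).

Lemma barrier_ge0 X Y : 0 <= barrier X Y.
Proof. by rewrite le_max lexx. Qed.

Lemma bump_scale_ge32 : 32 <= K.
Proof.
rewrite /bump_scale ler_peMr// ltW// expR_gt1 /bump_height.
move: l0; lra.
Qed.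

Lemma slit_bump_le s X Y : `|X| <= 2 -> slit_bump l s X Y <= 1 / 2 * (3 / 4 - X).
Proof.
move=> hX; rewrite /slit_bump gerBl mulr_ge0 ?expR_ge0// mulr_ge0//.
have : X ^+ 2 <= 2 ^+ 2 by rewrite -(real_normK (num_real X)) lerXn2r ?nnegrE.
lra.
Qed.

(** At heights up to [l + 1] the exponential is at least 1, and the subtracted term then exceeds the
    affine one. This covers the neighbouring holes with a margin of [1 / 20]. *)
Lemma slit_bump_lt0 s X Y : `|s| = 1 -> `|X| <= 21 / 20 -> `|Y| <= l + 1 ->
  slit_bump l s X Y < 0.
Proof.
move=> s1 hX hY; rewrite /slit_bump subr_lt0.
have X2 : X ^+ 2 <= (21 / 20) ^+ 2.
  by rewrite -(real_normK (num_real X)) lerXn2r ?nnegrE//; lra.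
have e1 : 1 <= expR ((l + 1 - s * Y) / 4).
  rewrite -[leLHS]expR0 ler_expR divr_ge0// subr_ge0.
  by rewrite (le_trans (ler_norm _))// normrM s1 mul1r.
have x1 : - X <= 21 / 20 by move: hX; rewrite ler_norml => /andP[]; lra.
apply: (@lt_le_trans _ _ (2 * (1 - X ^+ 2 / 4))).
  clear - X2 x1; move: (X ^+ 2) X2 => A X2; lra.
rewrite ler_peMr// mulr_ge0//.
clear - X2; move: (X ^+ 2) X2 => A X2; lra.
Qed.

Lemma slit_bump_high X Y : X <= 1 / 2 -> `|X| <= 21 / 20 -> H <= `|Y| ->
  1 / 16 <= Num.max (slit_bump l 1 X Y) (slit_bump l (- 1) X Y).
Proof.
move=> hX hX' hY.
have main s : H <= s * Y -> 1 / 16 <= slit_bump l s X Y.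
  move=> sY.
  (* The 125 in [bump_height] makes the exponent at most [- 31], and [expR 31 >= 1 + 31]. *)
  have e1 : expR ((l + 1 - s * Y) / 4) <= 1 / 32.
    rewrite -[_ / 4]opprK expRN div1r lef_pV2 ?posrE ?expR_gt0//.
    apply: le_trans (expR_ge1Dx _); move: sY; rewrite /bump_height; lra.
  have X0 := sqr_ge0 X.
  have X2 : X ^+ 2 <= (21 / 20) ^+ 2.
    by rewrite -(real_normK (num_real X)) lerXn2r ?nnegrE//; lra.
  have : (1 - X ^+ 2 / 4) * expR ((l + 1 - s * Y) / 4) <= 1 * (1 / 32).
    by rewrite ler_pM ?expR_ge0//; clear - X0 X2; move: (X ^+ 2) X0 X2 => A; lra.
  rewrite /slit_bump; lra.
rewrite le_max; have [Y0|Y0] := leP 0 Y.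
  by rewrite main// mul1r -(ger0_norm Y0).
by rewrite [X in _ || X]main ?orbT// mulN1r -(ltr0_norm Y0).
Qed.

(** This is what fixes [bump_scale]: the value [1 / 16] is the one of [slit_bump_high], and the
    height [H + 1] leaves room for one step above the truncation. *)
Lemma center_bump_le X Y : `|X| <= 1 / 2 -> `|Y| <= H + 1 ->
  center_bump l X Y <= 1 / 16.
Proof.
move=> hX hY; rewrite /center_bump ler_pdivrMr ?bump_scale_gt0//.
have X0 := sqr_ge0 X.
have X2 : X ^+ 2 <= (1 / 2) ^+ 2.
  by rewrite -(real_normK (num_real X)) lerXn2r ?nnegrE//; lra.
have q1 : (1 - X ^+ 2) * (1 - 4 * X ^+ 2) <= 1 * 1.
  by rewrite ler_pM//; clear - X0 X2; move: (X ^+ 2) X0 X2 => A; lra.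
have G1 : expR (6 * Y) + expR (- (6 * Y)) <= 2 * expR (6 * (H + 1)).
  move: hY; rewrite ler_norml => /andP[Y1 Y2].
  rewrite [leRHS](_ : _ = expR (6 * (H + 1)) + expR (6 * (H + 1))); last by ring.
  by rewrite lerD// ler_expR; lra.
rewrite /bump_scale.
have -> : 1 / 16 * (32 * expR (6 * (H + 1))) = 1 * (2 * expR (6 * (H + 1))) by field.
rewrite ler_pM ?addr_ge0 ?expR_ge0//; last lra.
by rewrite mulr_ge0//; clear - X0 X2; move: (X ^+ 2) X0 X2 => A; lra.
Qed.

Lemma center_bump_le0 X Y : 1 / 2 <= `|X| -> `|X| <= 1 -> center_bump l X Y <= 0.
Proof.
move=> hX hX1; rewrite /center_bump pmulr_lle0 ?invr_gt0 ?bump_scale_gt0//.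
rewrite pmulr_lle0 ?addr_gt0 ?expR_gt0// mulr_ge0_le0// -(real_normK (num_real X)).
  by rewrite subr_ge0 expr_le1.
have : (1 / 2) ^+ 2 <= `|X| ^+ 2 by rewrite lerXn2r ?nnegrE//; lra.
lra.
Qed.

Lemma center_bump_ge X Y : `|X| <= 1 / 20 -> K^-1 <= center_bump l X Y.
Proof.
move=> hX; rewrite /center_bump ler_peMl ?invr_ge0 ?(ltW (bump_scale_gt0 _))//.
have X0 := sqr_ge0 X.
have X2 : X ^+ 2 <= (1 / 20) ^+ 2.
  by rewrite -(real_normK (num_real X)) lerXn2r ?nnegrE//; lra.
have e1 := expR_ge1Dx (6 * Y); have e2 := expR_ge1Dx (- (6 * Y)).
have q1 : 3 / 4 * (3 / 4) <= (1 - X ^+ 2) * (1 - 4 * X ^+ 2).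
  by rewrite ler_pM//; clear - X0 X2; move: (X ^+ 2) X0 X2 => A; lra.
have : 3 / 4 * (3 / 4) * 2 <=
      (1 - X ^+ 2) * (1 - 4 * X ^+ 2) * (expR (6 * Y) + expR (- (6 * Y))).
  by rewrite ler_pM//; lra.
lra.
Qed.

(** The center bump gives the bound up to height [H] and the slit bumps above it, so that the whole
    gate is covered. *)
Lemma barrier_center X Y : `|X| <= 1 / 20 -> K^-1 <= barrier X Y.
Proof.
move=> hX; rewrite /barrier !le_max; apply/orP; right.
have [X1 X2] : `|X| <= 1 / 2 /\ `|X| <= 21 / 20 by split; lra.
rewrite X1/=; case: ifPn => YH; first by rewrite center_bump_ge.
rewrite -ltNge in YH; apply/orP; right.
have X3 : X <= 1 / 2 by rewrite (le_trans (ler_norm _)).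
rewrite ifT; last lra.
apply: le_trans (slit_bump_high X3 X2 (ltW YH)).
rewrite -div1r ler_pM2l// lef_pV2 ?posrE ?bump_scale_gt0//.
by rewrite (le_trans _ bump_scale_ge32)//; lra.
Qed.

Lemma measurable_center_bump :
  measurable_fun setT (fun z : R * R => center_bump l z.1 z.2).
Proof.
rewrite /center_bump.
apply: measurable_funM => //; apply: measurable_funM.
  apply: measurable_funM; apply: measurable_funB => //; last apply: measurable_funM => //;
  by apply: measurable_funX.
apply: measurable_funD; apply: measurableT_comp => //; last apply: measurableT_comp => //;
by apply: measurable_funM.
Qed.

Lemma measurable_slit_bump s :
  measurable_fun setT (fun z : R * R => slit_bump l s z.1 z.2).
Proof.
rewrite /slit_bump; apply: measurable_funB.
  by apply: measurable_funM => //; exact: measurable_funB.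
apply: measurable_funM.
  apply: measurable_funM => //; apply: measurable_funB => //.
  by apply: measurable_funM => //; exact: measurable_funX.
apply: measurableT_comp => //; apply: measurable_funM => //.
by apply: measurable_funB => //; exact: measurable_funM.
Qed.

Lemma measurable_barrier :
  measurable_fun setT (fun z : R * R => barrier z.1 z.2).
Proof.
rewrite /barrier; apply: measurable_maxr => //; apply: measurable_maxr.
  apply: measurable_fun_ifT => //; last exact: measurable_center_bump.
  apply: measurable_and.
    by apply: measurable_fun_ler => //; exact: measurableT_comp.
  by apply: measurable_fun_ler => //; exact: measurableT_comp.
apply: measurable_fun_ifT => //; first exact: measurable_fun_ler.
by apply: measurable_maxr; exact: measurable_slit_bump.
Qed.

(* The barrier is a maximum of subharmonic pieces, each truncated where another
   piece dominates it; hence near (X, Y) it dominates whichever piece attains it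
   there. *)
Lemma barrier_active (X Y : R) : - 1 <= X -> exists g : R -> R -> R,
  [/\ measurable_fun setT (fun z : R * R => g z.1 z.2),
      g X Y = barrier X Y,
      (forall a b, `|a| <= 1 / 20 -> `|b| <= 1 / 20 ->
        8 * g X Y <= sum8 (fun a b => g (X + a) (Y + b)) a b) &
      (forall X' Y', `|X' - X| <= 1 / 20 -> `|Y' - Y| <= 1 / 20 ->
        [/\ g X' Y' <= 1, - 1 <= X' -> g X' Y' <= barrier X' Y' &
            19 / 20 <= `|X'| -> `|Y'| <= l + 1 / 20 -> g X' Y' <= 0])].
Proof.
move=> X1.
have slit_case s : s ^+ 2 = 1 -> `|s| = 1 ->
    (forall X Y, slit_bump l s X Y <=
       Num.max (slit_bump l 1 X Y) (slit_bump l (- 1) X Y)) ->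
    slit_bump l s X Y = barrier X Y -> X <= 1 -> exists g : R -> R -> R,
  [/\ measurable_fun setT (fun z : R * R => g z.1 z.2),
      g X Y = barrier X Y,
      (forall a b, `|a| <= 1 / 20 -> `|b| <= 1 / 20 ->
        8 * g X Y <= sum8 (fun a b => g (X + a) (Y + b)) a b) &
      (forall X' Y', `|X' - X| <= 1 / 20 -> `|Y' - Y| <= 1 / 20 ->
        [/\ g X' Y' <= 1, - 1 <= X' -> g X' Y' <= barrier X' Y' &
            19 / 20 <= `|X'| -> `|Y'| <= l + 1 / 20 -> g X' Y' <= 0])].
  move=> s2 s1 smax sE X1'; exists (slit_bump l s); split => //.
  - exact: measurable_slit_bump.
  - by move=> a b ha hb; apply: sum8_slit_bump => //; rewrite ler_norml X1.
  - move=> X' Y'; rewrite ler_norml => /andP[x1 x2] hy.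
    (* An active slit bump is non-negative, which keeps [X] away from the truncation at 1. *)
    have X34 : X <= 3 / 4.
      have := barrier_ge0 X Y; rewrite -sE => /le_trans/(_ (@slit_bump_le s X Y _)).
      have hX2 : `|X| <= 2 by rewrite ler_norml; apply/andP; split; lra.
      by move=> /(_ hX2); lra.
    have hX' : `|X'| <= 21 / 20 by rewrite ler_norml; apply/andP; split; lra.
    have hX'2 : `|X'| <= 2 by lra.
    have le1 := @slit_bump_le s X' Y' hX'2.
    split.
    + by apply: le_trans le1 _; lra.
    + move=> X'1; rewrite /barrier !le_max; apply/orP; right; apply/orP; right.
      by rewrite ifT ?smax//; lra.
    + by move=> _ hY; rewrite ltW// slit_bump_lt0//; lra.
have : [\/ barrier X Y = 0,
  [/\ `|X| <= 1 / 2, `|Y| <= H & barrier X Y = center_bump l X Y],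
  X <= 1 /\ slit_bump l 1 X Y = barrier X Y |
  X <= 1 /\ slit_bump l (- 1) X Y = barrier X Y].
  rewrite /barrier; set A := (if _ && _ then _ else _).
  set B := (if X <= 1 then _ else _).
  case: (leP 0 (Num.max A B)) => [_|]; last by constructor 1.
  case: (leP A B) => _.
    rewrite /B; case: ifPn => [X1' |_]; last by constructor 1.
    by case: (leP (slit_bump l 1 X Y)) => _; [constructor 4|constructor 3].
  rewrite /A; case: ifPn => [/andP[]|_]; last by constructor 1.
  by constructor 2.
case=> [b0|[hX hY bE]|[X1' bE]|[X1' bE]].
- exists (fun _ _ => 0); split => //.
    by move=> a b _ _; rewrite /sum8; lra.
  by move=> X' Y' _ _; split => // _; exact: barrier_ge0.
- exists (center_bump l); split => //.
  + exact: measurable_center_bump.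
  + by move=> a b; exact: sum8_center_bump.
  + move=> X' Y' hx hy.
    have hX' : `|X'| <= 1 / 2 + 1 / 20.
      by rewrite -[X'](subrK X) addrC (le_trans (ler_normD _ _))// lerD.
    have hY' : `|Y'| <= H + 1.
      by rewrite -[Y'](subrK Y) addrC (le_trans (ler_normD _ _))// lerD//; lra.
    (* Past [|X'| = 1 / 2] the center bump is non-positive, and past [|Y'| = H] it is at most
       [1 / 16], hence below a slit bump. *)
    have [X'2|/ltW X'2] := leP `|X'| (1 / 2); last first.
      have le0 : center_bump l X' Y' <= 0 by apply: center_bump_le0 => //; lra.
      split => //; first by lra.
      by move=> _; apply: le_trans le0 (barrier_ge0 _ _).
    have le16 := center_bump_le X'2 hY'.
    split; first lra; last by move=> ? _; lra.
    move=> X'1; rewrite /barrier X'2/=; case: ifPn => hYH.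
      by rewrite !le_max lexx/= orbT.
    rewrite -ltNge in hYH; rewrite !le_max ifT; last first.
      by rewrite (le_trans (ler_norm _))//; lra.
    have X'3 : X' <= 1 / 2 by rewrite (le_trans (ler_norm _)).
    have X'4 : `|X'| <= 21 / 20 by lra.
    by rewrite (le_trans le16 (slit_bump_high X'3 X'4 (ltW hYH))) !orbT.
- apply: (slit_case 1) => //; [exact: expr1n|exact: normr1|].
  by move=> ? ?; rewrite le_max lexx.
- apply: (slit_case (- 1)) => //; [by rewrite sqrrN expr1n|by rewrite normrN1|].
  by move=> ? ?; rewrite le_max lexx orbT.
Qed.

End barrier_function.

(** * The Lyapunov function *)

Section bigmin_seq.
Context {R : realType} {I : eqType}.

Lemma bigmin_attained (s : seq I) (F : I -> R) (d : R) :
  \big[Num.min/d]_(i <- s) F i = d \/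
  exists2 i, i \in s & \big[Num.min/d]_(i <- s) F i = F i.
Proof.
elim: s => [|i s [IH|[j js IH]]]; first by left; rewrite big_nil.
- rewrite big_cons IH; have [_|_] := leP (F i) d; last by left.
  by right; exists i; rewrite ?mem_head.
- rewrite big_cons IH; right; have [_|_] := leP (F i) (F j).
    by exists i; rewrite ?mem_head.
  by exists j; rewrite // in_cons js orbT.
Qed.

Lemma bigmin_le_mem (s : seq I) (F : I -> R) (d : R) i :
  i \in s -> \big[Num.min/d]_(i <- s) F i <= F i.
Proof.
elim: s => // j s IH; rewrite in_cons big_cons ge_min => /orP[/eqP->|/IH->].
  by rewrite lexx.
by rewrite orbT.
Qed.

Lemma measurable_bigmin d (T : measurableType d) (s : seq I)
    (F : I -> T -> R) (c : R) :
  (forall i, measurable_fun setT (F i)) ->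
  measurable_fun setT (fun t => \big[Num.min/c]_(i <- s) F i t).
Proof.
move=> mF; elim: s => [|i s IH].
  by under eq_fun do rewrite big_nil; exact: measurable_cst.
by under eq_fun do rewrite big_cons; exact: measurable_minr.
Qed.

Lemma measurable_all d (T : measurableType d) (s : seq I) (F : I -> T -> bool) :
  (forall i, measurable_fun setT (F i)) ->
  measurable_fun setT (fun t => all (F ^~ t) s).
Proof.
move=> mF; elim: s => [|i s IH] //=.
exact: measurable_and.
Qed.

End bigmin_seq.

Section lyapunov.
Context {R : realType} (l : R) (x b : int -> R) (J : nat) (r : R).
Implicit Types (z : R * R) (n : int).

Local Notation K := (bump_scale l).

Definition leak : R := K^-1 / 16.
Definition growth : R := (1 - K^-1 / 4) / (1 - K^-1 / 2).

Definition width n : R := Num.min (gap x n) (gap x (n + 1)).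
Definition side n : R := if gap x n <= gap x (n + 1) then 1 else - 1.

(* The flip by side n puts the nearer neighbouring gate at rescaled abscissa -1; the
   other one lies at abscissa at least 1. *)
Definition level n z : R :=
  1 - barrier l (side n * (z.1 - x n) / width n) (z.2 / width n) / 2
    - leak * (z.1 - x n) ^+ 2 / max_gap_sq x J.

Definition levels : seq int :=
  [seq k%:Z - J%:Z + 1 | k <- iota 0 (2 * J).-1].

Lemma mem_levels n : (n \in levels) = (`|n| < J)%N.
Proof.
apply/mapP/idP => [[k]|nJ].
  by rewrite mem_iota => kJ ->; lia.
by exists (absz (n + J%:Z - 1)%R); [rewrite mem_iota; lia|lia].
Qed.

Definition in_range z : bool := (x (- J%:Z) < z.1) && (z.1 < x J%:Z).

Definition in_strip n z : bool := (x (n - 1) <= z.1) && (z.1 <= x (n + 1)).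

(** In range, [growth ^+ J] is neutral: [in_rangeP] and [lyapunov_le] put the minimum below it. The
    value out of range is a lower bound, valid within one step of their strips, for the functions of
    the outermost gates [|n| = J - 1]. *)
Definition lyapunov z : R :=
  if in_range z then
    \big[Num.min/growth ^+ J]_(n <- levels)
      (if in_strip n z then growth ^+ `|n| * level n z else growth ^+ J)
  else growth ^+ J.-1 / 4.

(** What a path avoiding the slits [|m| < J] shows at two close times. The crossing itself takes
    place between them, whence the tolerance [r] on the height of the end point. *)
Definition admissible z z' : bool :=
  [&& `|z'.1 - z.1| <= r, `|z'.2 - z.2| <= r &
      all (fun m => (((z.1 <= x m) && (x m <= z'.1)) ||
                     ((z'.1 <= x m) && (x m <= z.1))) ==>
                    (`|z'.2| <= b m + r)) levels].

Hypothesis x_mono : {homo x : m n / m < n}.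

Lemma gap_gt0 n : 0 < gap x n.
Proof. by rewrite /gap subr_gt0 x_mono// ltrBlDr ltrDl. Qed.

Lemma width_gt0 n : 0 < width n.
Proof. by rewrite /width lt_min !gap_gt0. Qed.

Lemma x_le m n : m <= n -> x m <= x n.
Proof. by rewrite le_eqVlt => /orP[/eqP->|/x_mono/ltW]. Qed.

Lemma max_gap_sq_ge n : (`|n| <= J)%N -> gap x n ^+ 2 <= max_gap_sq x J.
Proof.
move=> nJ; have kJ : (`|n| < J.+1)%N by [].
apply: le_trans (le_bigmax _ _ (Ordinal kJ)) => /=.
rewrite le_max; have [n0|n0] := leP 0 n.
  by rewrite gez0_abs// lexx.
by rewrite ltz0_abs// opprK lexx orbT.
Qed.

Lemma max_gap_sq_gt0 : 0 < max_gap_sq x J.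
Proof.
by apply: lt_le_trans (@max_gap_sq_ge 0 _); rewrite ?absz0// exprn_gt0// gap_gt0.
Qed.

(** Of the two gates around [z.1], located by the least [k], the one with index nearer to 0 is
    taken; the other may have index [J] or [- J]. *)
Lemma in_rangeP z : in_range z -> exists2 n, (`|n| < J)%N & in_strip n z.
Proof.
move=> /andP[zl zr].
have ex : exists k : nat, z.1 < x (k%:Z - J%:Z).
  by exists (2 * J)%N; rewrite (_ : _ - _ = J%:Z)//; lia.
have [k zk kmin] := ex_minnP ex.
have k0 : (0 < k)%N.
  rewrite lt0n; apply/eqP => k0; move: zk; rewrite k0 sub0r.
  by move=> /(lt_trans zl); rewrite ltxx.
have zk' : x (k%:Z - J%:Z - 1) <= z.1.
  rewrite leNgt; apply/negP => zk'.
  have := kmin k.-1; rewrite (_ : k.-1%:Z - J%:Z = k%:Z - J%:Z - 1); last by lia.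
  by move=> /(_ zk'); lia.
have kJ : (k <= 2 * J)%N by apply: kmin; rewrite (_ : _ - _ = J%:Z)//; lia.
have [k_le|k_gt] := leqP k J.
  exists (k%:Z - J%:Z); first lia.
  by rewrite /in_strip zk'/= (le_trans (ltW zk))// x_le//; lia.
exists (k%:Z - J%:Z - 1); first lia.
rewrite /in_strip subrK (ltW zk) andbT (le_trans _ zk')// x_le//; lia.
Qed.

Lemma in_strip_ge n z : in_strip n z -> - 1 <= side n * (z.1 - x n) / width n.
Proof.
move=> /andP[z1 z2]; rewrite ler_pdivlMr ?width_gt0// mulN1r /side /width.
case: ifPn => [g|]; first by rewrite mul1r min_l// /gap; lra.
rewrite -ltNge => /ltW g; rewrite min_r// mulN1r lerN2 /gap addrK; lra.
Qed.

Lemma measurable_level n : measurable_fun setT (level n).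
Proof.
apply: measurable_funB.
  apply: measurable_funB => //; apply: measurable_funM => //.
  pose h (z : R * R) := (side n * (z.1 - x n) / width n, z.2 / width n).
  have mh : measurable_fun setT h.
    apply: measurable_fun_pair => /=; apply: measurable_funM => //.
    by apply: measurable_funM => //; exact: measurable_funB.
  exact: (measurableT_comp (measurable_barrier l) mh).
apply: measurable_funM => //; apply: measurable_funM => //.
by apply: measurable_funX; exact: measurable_funB.
Qed.

Lemma measurable_in_range : measurable_fun setT in_range.
Proof. by apply: measurable_and; exact: measurable_fun_ltr. Qed.

Lemma measurable_in_strip n : measurable_fun setT (in_strip n).
Proof. by apply: measurable_and; exact: measurable_fun_ler. Qed.

Lemma measurable_lyapunov : measurable_fun setT lyapunov.
Proof.
apply: measurable_fun_ifT => //; first exact: measurable_in_range.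
apply: measurable_bigmin => n; apply: measurable_fun_ifT => //.
  exact: measurable_in_strip.
by apply: measurable_funM => //; exact: measurable_level.
Qed.

Lemma measurable_admissible :
  measurable_fun setT (fun zz : (R * R) * (R * R) => admissible zz.1 zz.2).
Proof.
have m1 : measurable_fun setT (fun zz : (R * R) * (R * R) => zz.1.1).
  exact: measurableT_comp.
have m2 : measurable_fun setT (fun zz : (R * R) * (R * R) => zz.2.1).
  exact: measurableT_comp.
have m3 : measurable_fun setT (fun zz : (R * R) * (R * R) => zz.1.2).
  exact: measurableT_comp.
have m4 : measurable_fun setT (fun zz : (R * R) * (R * R) => zz.2.2).
  exact: measurableT_comp.
apply: measurable_and.
  apply: measurable_fun_ler => //; apply: measurableT_comp => //.
    exact: measurable_funB.
apply: measurable_and.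
  apply: measurable_fun_ler => //; apply: measurableT_comp => //.
    exact: measurable_funB.
apply: measurable_all => m; under eq_fun do rewrite implybE.
apply: measurable_or; last first.
  by apply: measurable_fun_ler => //; exact: measurableT_comp.
by apply: measurable_neg; apply: measurable_or; apply: measurable_and;
  exact: measurable_fun_ler.
Qed.

Hypothesis l0 : 0 < l.

Lemma scale_bounds : 0 < K^-1 <= 1 / 32.
Proof.
rewrite invr_gt0 bump_scale_gt0/= -div1r ler_pM2l// lef_pV2 ?posrE ?bump_scale_gt0//.
exact: bump_scale_ge32.
Qed.

Lemma growth_gt1 : 1 < growth.
Proof.
have /andP[k0 k1] := scale_bounds.
by rewrite /growth ltr_pdivlMr; lra.
Qed.

(** In the hole of a neighbouring gate, the level of that gate is at most [1 - K^-1 / 2], while the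
    factor of the current gate is still at least [1 - 4 * leak]. The definition of [growth] makes
    the two match after passing to the next power. *)
Lemma growth_leak : growth * (1 - K^-1 / 2) = 1 - 4 * leak.
Proof.
have /andP[k0 k1] := scale_bounds.
rewrite /growth /leak divfK; first by field; rewrite gt_eqF// bump_scale_gt0.
by rewrite gt_eqF//; lra.
Qed.

Lemma lyapunov_le z n : in_range z -> (`|n| < J)%N -> in_strip n z ->
  lyapunov z <= growth ^+ `|n|.
Proof.
move=> zr nJ ns; rewrite /lyapunov zr.
apply: le_trans (bigmin_le_mem _ _ _) _; first by rewrite mem_levels; exact: nJ.
rewrite /= ns ler_piMr ?exprn_ge0// ?(ltW (lt_trans ltr01 growth_gt1))//.
have /andP[k0 k1] := scale_bounds.
rewrite /level -addrA -opprD gerBl addr_ge0 ?divr_ge0 ?barrier_ge0//.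
  by rewrite mulr_ge0 ?sqr_ge0// /leak; lra.
exact: ltW max_gap_sq_gt0.
Qed.

(** As [growth > 1], the default value stays strictly above the minimum, so a genuine gate attains
    it. *)
Lemma lyapunov_active z : in_range z -> exists n,
  [/\ (`|n| < J)%N, in_strip n z & lyapunov z = growth ^+ `|n| * level n z].
Proof.
move=> zr; have [n0 n0J n0s] := in_rangeP zr.
have lt_top : lyapunov z < growth ^+ J.
  by rewrite (le_lt_trans (lyapunov_le zr n0J n0s))// ltr_eXn2l// growth_gt1.
move: lt_top; rewrite /lyapunov zr.
pose F n := if in_strip n z then growth ^+ `|n| * level n z else growth ^+ J.
have [E|[n ns E]] := bigmin_attained levels F (growth ^+ J).
  by rewrite E ltxx.
rewrite E /F => lt_top; exists n; rewrite -mem_levels ns; move: lt_top.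
by case: ifPn => // _; rewrite ltxx.
Qed.

Lemma side_normr n : `|side n| = 1.
Proof. by rewrite /side; case: ifP; rewrite ?normrN1 ?normr1. Qed.

Lemma normr_scale n u : `|side n * u / width n| = `|u| / width n.
Proof. by rewrite !normrM side_normr mul1r normfV (gtr0_norm (width_gt0 n)). Qed.

Lemma in_strip_dist n z : (`|n| < J)%N -> in_strip n z ->
  (z.1 - x n) ^+ 2 <= max_gap_sq x J.
Proof.
move=> nJ /andP[z1 z2]; have [zx|zx] := leP (x n) z.1.
  apply: (@le_trans _ _ (gap x (n + 1) ^+ 2)); last by apply: max_gap_sq_ge; lia.
  by rewrite lerXn2r ?nnegrE ?(ltW (gap_gt0 _)) ?subr_ge0// /gap addrK; lra.
apply: (@le_trans _ _ (gap x n ^+ 2)); last by apply: max_gap_sq_ge; lia.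
by rewrite -sqrrN opprB lerXn2r ?nnegrE ?(ltW (gap_gt0 _)) ?subr_ge0
    ?(ltW zx)// /gap; lra.
Qed.

Lemma width_le_max n : (`|n| < J)%N -> width n ^+ 2 <= max_gap_sq x J.
Proof.
move=> nJ; apply: (@le_trans _ _ (gap x n ^+ 2)); last by apply: max_gap_sq_ge; lia.
by rewrite lerXn2r ?nnegrE ?(ltW (gap_gt0 _)) ?(ltW (width_gt0 _))// /width ge_min lexx.
Qed.

(** * One step of length at most [r] in each coordinate *)

Hypothesis b_ub : forall n, Num.max (b (n - 1)) (b (n + 1)) <= l * width n.
Hypothesis r_gt0 : 0 < r.
Hypothesis r_ub : forall n, (`|n| < J)%N -> r <= width n / 20.

Lemma near_strip_dist n z z' : (`|n| < J)%N -> in_strip n z -> `|z'.1 - z.1| <= r ->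
  (z'.1 - x n) ^+ 2 <= 4 * max_gap_sq x J.
Proof.
move=> nJ zs hr; have d1 := in_strip_dist nJ zs.
have d2 : (z'.1 - z.1) ^+ 2 <= max_gap_sq x J.
  apply: le_trans (width_le_max nJ).
  rewrite -(real_normK (num_real (z'.1 - z.1))) lerXn2r ?nnegrE ?(ltW (width_gt0 _))//.
  by apply: le_trans hr (le_trans (r_ub nJ) _); have := width_gt0 n; lra.
have -> : z'.1 - x n = (z'.1 - z.1) + (z.1 - x n) by lra.
move: d1 d2; move: (z'.1 - z.1) (z.1 - x n) => u v d1 d2.
have : 0 <= (u - v) ^+ 2 by exact: sqr_ge0.
have -> : (u - v) ^+ 2 = 2 * u ^+ 2 + 2 * v ^+ 2 - (u + v) ^+ 2 by ring.
move: d1 d2; move: (u ^+ 2) (v ^+ 2) ((u + v) ^+ 2) => *; lra.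
Qed.

Lemma r_lt_gap m : (`|m| < J)%N -> r < gap x m /\ r < gap x (m + 1).
Proof.
move=> mJ; have := r_ub mJ; have := width_gt0 m.
have : width m <= gap x m /\ width m <= gap x (m + 1).
  by rewrite /width !ge_min !lexx orbT.
by case=> ? ? ? ?; split; lra.
Qed.

(** If [|n| < J - 1], a step is shorter than the gaps next to the strip of gate [n]; hence it cannot
    reach gate [n - 2] or [n + 2], and both have index at most [J] in absolute value. *)
Lemma range_exit n z z' : (`|n| < J)%N -> in_strip n z -> `|z'.1 - z.1| <= r ->
  ~~ in_range z' -> `|n|%N = J.-1.
Proof.
move=> nJ /andP[z1 z2]; rewrite ler_norml => /andP[h1 h2] out.
apply/eqP; rewrite eqn_leq; apply/andP; split; first by clear -nJ; lia.
rewrite leqNgt; apply/negP => nJ1; move/negP: out; apply; apply/andP; split.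
  have mJ : (`|(n - 1)%R| < J)%N by clear -nJ1; lia.
  have [+ _] := r_lt_gap mJ; rewrite /gap => rm.
  have : x (- J%:Z) <= x (n - 1 - 1) by apply: x_le; clear -nJ1; lia.
  by clear -rm z1 h1; lra.
have mJ : (`|(n + 1)%R| < J)%N by clear -nJ1; lia.
have [_] := r_lt_gap mJ; rewrite /gap addrK => rm.
have : x (n + 1 + 1) <= x J%:Z by apply: x_le; clear -nJ1; lia.
by clear -rm z2 h2; lra.
Qed.

Lemma strip_exit_left n z z' : (`|n| < J)%N -> in_strip n z ->
  `|z'.1 - z.1| <= r -> in_range z' -> z'.1 < x (n - 1) ->
  (`|(n - 1)%R| < J)%N /\ in_strip (n - 1) z'.
Proof.
move=> nJ /andP[z1 z2]; rewrite ler_norml => /andP[h1 h2] /andP[zl zr] z'n.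
have mJ : (`|(n - 1)%R| < J)%N.
  suff : - J%:Z < n - 1 by clear -nJ; lia.
  by rewrite ltNge; apply/negP => /x_le; rewrite leNgt (lt_trans zl z'n).
split => //; have [+ _] := r_lt_gap mJ; rewrite /gap => rm.
apply/andP; split; first lra.
by rewrite subrK (le_trans (ltW z'n))// x_le//; clear; lia.
Qed.

Lemma strip_exit_right n z z' : (`|n| < J)%N -> in_strip n z ->
  `|z'.1 - z.1| <= r -> in_range z' -> x (n + 1) < z'.1 ->
  (`|(n + 1)%R| < J)%N /\ in_strip (n + 1) z'.
Proof.
move=> nJ /andP[z1 z2]; rewrite ler_norml => /andP[h1 h2] /andP[zl zr] z'n.
have mJ : (`|(n + 1)%R| < J)%N.
  suff : n + 1 < J%:Z by clear -nJ; lia.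
  by rewrite ltNge; apply/negP => /x_le; rewrite leNgt (lt_trans z'n zr).
split => //; have [_] := r_lt_gap mJ; rewrite /gap addrK => rm.
apply/andP; split; last lra.
by rewrite addrK (le_trans _ (ltW z'n))// x_le//; clear; lia.
Qed.

(** Here [f] is the function of a gate attaining the minimum at [z], with the barrier replaced by
    its piece [g] active at [z]. The eight-point sum also visits inadmissible points, where the
    Lyapunov function need not be below [f]; non-negativity of [f] is enough there, since the walk
    is killed. *)
Lemma lyapunov_step z : in_range z -> exists f : R * R -> R,
  [/\ measurable_fun setT f, f z = lyapunov z,
      1 / 4 <= lyapunov z,
      (forall a b, `|a| <= r -> `|b| <= r ->
         sum8 (fun a b => f (z.1 + a, z.2 + b)) a b +
         lyapunov z * (4 * leak / max_gap_sq x J) * (a ^+ 2 + b ^+ 2)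
         <= 8 * lyapunov z) &
      (forall z', `|z'.1 - z.1| <= r -> `|z'.2 - z.2| <= r ->
         0 <= f z' /\ (admissible z z' -> lyapunov z' <= f z'))].
Proof.
move=> zr; have [n [nJ zs zE]] := lyapunov_active zr.
have w0 := width_gt0 n.
have [g [mg gE g8 gloc]] := @barrier_active R l _ (z.2 / width n) (in_strip_ge zs).
pose X (t : R) := side n * (t - x n) / width n.
pose Y (t : R) := t / width n.
pose f (z : R * R) : R := growth ^+ `|n| *
  (1 - g (X z.1) (Y z.2) / 2 - leak * (z.1 - x n) ^+ 2 / max_gap_sq x J).
have fE : f z = lyapunov z by rewrite zE /f /level gE.
have mu1 := growth_gt1.
have mun0 : 0 < growth ^+ `|n| by rewrite exprn_gt0// (lt_trans ltr01).
have /andP[k0 k1] := scale_bounds.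
have M0 := max_gap_sq_gt0.
have lk0 : 0 < leak by rewrite /leak; lra.
have rw : r / width n <= 1 / 20.
  by rewrite ler_pdivrMr//; have := r_ub nJ; lra.
have Xd t t' : `|t' - t| <= r -> `|X t' - X t| <= 1 / 20.
  move=> tr; rewrite /X -mulrBl -mulrBr opprB addrA subrK.
  rewrite normr_scale.
  by apply: le_trans rw; rewrite ler_pM2r ?invr_gt0.
have Yd t t' : `|t' - t| <= r -> `|Y t' - Y t| <= 1 / 20.
  move=> tr; rewrite /Y -mulrBl normrM normfV (gtr0_norm w0).
  by apply: le_trans rw; rewrite ler_pM2r ?invr_gt0.
(* The factor is at least [1 - 1 / 2 - 4 * leak]. *)
have flow z' : `|z'.1 - z.1| <= r -> `|z'.2 - z.2| <= r ->
    growth ^+ `|n| / 4 <= f z'.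
  move=> h1 h2; rewrite /f ler_pM2l//.
  have [g1 _ _] := gloc _ _ (Xd _ _ h1) (Yd _ _ h2).
  have : leak * (z'.1 - x n) ^+ 2 / max_gap_sq x J <= leak * 4.
    by rewrite -mulrA ler_pM2l// ler_pdivrMr// (near_strip_dist nJ zs h1).
  rewrite /leak; rewrite /X /Y in g1 *; lra.
have mun1 : 1 <= growth ^+ `|n| by rewrite exprn_ege1// ltW.
exists f; split => //.
- apply: measurable_funM => //; apply: measurable_funB.
    apply: measurable_funB => //; apply: measurable_funM => //.
    have mh : measurable_fun setT (fun z : R * R => (X z.1, Y z.2)).
      apply: measurable_fun_pair => /=; apply: measurable_funM => //.
      by apply: measurable_funM => //; exact: measurable_funB.
    exact: (measurableT_comp mg mh).
  apply: measurable_funM => //; apply: measurable_funM => //.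
  by apply: measurable_funX; exact: measurable_funB.
- rewrite -fE; apply: le_trans (flow z _ _); rewrite ?subrr ?normr0 ?(ltW r_gt0)//.
  by rewrite ler_pM2r.
- move=> a c ha hc.
  have wn0 : 0 < (width n)^-1 by rewrite invr_gt0.
  have small u : `|u| <= r -> `|u / width n| <= 1 / 20.
    move=> ur; rewrite normrM normfV (gtr0_norm w0).
    by apply: le_trans rw; rewrite ler_pM2r.
  pose G u v := g (X z.1 + side n * (u / width n)) (Y z.2 + v / width n).
  have GS : 8 * G 0 0 <= sum8 G a c.
    have := g8 _ _ (small _ ha) (small _ hc).
    rewrite /G !mul0r mulr0 !addr0 => /le_trans; apply.
    (* The flip by [side n] only permutes the eight terms. *)
    rewrite /sum8 /G !mulNr /side -/(X z.1) -/(Y z.2).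
    by case: ifP => _; rewrite ?mul1r ?mulN1r ?opprK; lra.
  pose t := z.1 - x n.
  have fG u v : f (z.1 + u, z.2 + v) = growth ^+ `|n| *
      (1 - G u v / 2 - leak * (t + u) ^+ 2 / max_gap_sq x J).
    rewrite /f /= /G /X /Y /t; congr (_ * (1 - g _ _ / 2 - leak * _ ^+ 2 / _)); ring.
  (* The squares in the leak term contribute [4 * (a ^+ 2 + c ^+ 2)]: this is the source of the
     strict decrease. *)
  have SE : sum8 (fun a b => f (z.1 + a, z.2 + b)) a c = growth ^+ `|n| *
    (8 - sum8 G a c / 2 - leak * (8 * t ^+ 2 + 4 * (a ^+ 2 + c ^+ 2)) / max_gap_sq x J).
    by rewrite /sum8 !fG; ring.
  have fz : lyapunov z =
      growth ^+ `|n| * (1 - G 0 0 / 2 - leak * t ^+ 2 / max_gap_sq x J).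
    by have := fG 0 0; rewrite !addr0 -surjective_pairing fE.
  have G0 : 0 <= G 0 0.
    by rewrite /G !mul0r mulr0 !addr0 /X /Y gE barrier_ge0.
  have lM : 0 <= leak * t ^+ 2 / max_gap_sq x J.
    by rewrite divr_ge0 ?(ltW M0)// mulr_ge0 ?sqr_ge0// ltW.
  (* This makes the decrease proportional to [lyapunov z] itself, as exponential decay requires. *)
  have Vle : lyapunov z <= growth ^+ `|n|.
    by rewrite fz ler_piMr// ?(ltW mun0)//; lra.
  have k3 : lyapunov z * (4 * leak / max_gap_sq x J) * (a ^+ 2 + c ^+ 2) <=
      growth ^+ `|n| * (4 * leak / max_gap_sq x J * (a ^+ 2 + c ^+ 2)).
    rewrite -mulrA ler_wpM2r//.
    by rewrite mulr_ge0 ?addr_ge0 ?sqr_ge0// divr_ge0 ?(ltW M0)// mulr_ge0// ltW.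
  apply: le_trans (lerD (lexx _) k3) _.
  rewrite SE -mulrDr fz [leRHS]mulrCA ler_pM2l//.
  have -> : leak * (8 * t ^+ 2 + 4 * (a ^+ 2 + c ^+ 2)) / max_gap_sq x J =
     8 * (leak * t ^+ 2 / max_gap_sq x J) +
     4 * leak / max_gap_sq x J * (a ^+ 2 + c ^+ 2) by ring.
  clear - GS; lra.
- move=> z' h1 h2; split; first by apply: le_trans (flow _ h1 h2); rewrite divr_ge0// ltW.
  have [z1 z2] := andP zs.
  move: (h1); rewrite ler_norml => /andP[h1l h1r].
  move=> adm; have [z'r|z'out] := boolP (in_range z'); last first.
    rewrite /lyapunov (negbTE z'out); apply: le_trans (flow _ h1 h2).
    rewrite ler_pM2r ?invr_gt0//.
    by rewrite (range_exit nJ zs h1 z'out).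
  have [_ _ /allP adm3] := and3P adm.
  (* After crossing gate [m], the point [z'] is within [r] of its hole. There [g] is at most 0 while
     the barrier of [m] is at least [K^-1], and [growth_leak] compares the functions of the two
     gates. *)
  have gate m : (`|m| < J)%N -> (m == n - 1) || (m == n + 1) ->
     ((z.1 <= x m) && (x m <= z'.1)) || ((z'.1 <= x m) && (x m <= z.1)) ->
     in_strip m z' -> lyapunov z' <= f z'.
    move=> mJ mn cr ms.
    have wm0 := width_gt0 m.
    have y' : `|z'.2| <= b m + r.
      by have := adm3 m; rewrite mem_levels => /(_ mJ); rewrite cr.
    have bm : b m <= l * width n.
      apply: le_trans (b_ub n); rewrite le_max.
      by case/orP: mn => /eqP->; rewrite lexx ?orbT.
    have xm : `|z'.1 - x m| <= r.
      by rewrite ler_norml; case/orP: cr => /andP[c1 c2]; apply/andP; split;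
        clear -c1 c2 h1l h1r r_gt0; lra.
    have bar : K^-1 <= barrier l (side m * (z'.1 - x m) / width m) (z'.2 / width m).
      apply: barrier_center => //; rewrite normr_scale.
      by rewrite ler_pdivrMr// (le_trans xm)//; have := r_ub mJ; lra.
    have far : 19 / 20 <= `|X z'.1|.
      rewrite /X normr_scale ler_pdivlMr//.
      have xmn : width n <= `|x m - x n|.
        have [w1 w2] : width n <= gap x n /\ width n <= gap x (n + 1).
          by rewrite /width !ge_min !lexx orbT.
        move: w1 w2; rewrite /gap addrK => w1 w2.
        case/orP: mn => /eqP->.
          by rewrite distrC (le_trans w1)// ler_norm.
        by rewrite (le_trans w2)// ler_norm.
      have : `|x m - x n| <= `|z'.1 - x n| + `|z'.1 - x m|.
        have -> : x m - x n = (z'.1 - x n) - (z'.1 - x m) by ring.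
        exact: ler_normB.
      have := r_ub nJ; lra.
    have ylow : `|Y z'.2| <= l + 1 / 20.
      rewrite /Y normrM normfV (gtr0_norm w0) ler_pdivrMr// (le_trans y')//.
      by rewrite mulrDl lerD//; have := r_ub nJ; lra.
    have [_ _ /(_ far ylow) g0] := gloc _ _ (Xd _ _ h1) (Yd _ _ h2).
    apply: (@le_trans _ _ (growth ^+ `|n| * (1 - 4 * leak))).
      rewrite /lyapunov z'r.
      apply: le_trans (bigmin_le_mem _ _ _) _; first by rewrite mem_levels; exact: mJ.
      rewrite /= ms -growth_leak mulrA.
      have lv : level m z' <= 1 - K^-1 / 2.
        rewrite /level.
        have : 0 <= leak * (z'.1 - x m) ^+ 2 / max_gap_sq x J.
          by rewrite divr_ge0 ?(ltW M0)// mulr_ge0 ?sqr_ge0// ltW.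
        lra.
      have p1 : growth ^+ `|m| <= growth ^+ `|n| * growth.
        by rewrite -exprSr ler_weXn2l ?(ltW mu1)//; clear -mn; lia.
      apply: (@le_trans _ _ (growth ^+ `|m| * (1 - K^-1 / 2))).
        by rewrite ler_pM2l// exprn_gt0// (lt_trans ltr01).
      by rewrite ler_wpM2r//; lra.
    rewrite /f ler_pM2l//.
    have : leak * (z'.1 - x n) ^+ 2 / max_gap_sq x J <= leak * 4.
      by rewrite -mulrA ler_pM2l// ler_pdivrMr// (near_strip_dist nJ zs h1).
    by rewrite /X /Y in g0 *; lra.
  have [z'l z'h] := andP z'r.
  have [z'n|z'n] := ltP z'.1 (x (n - 1)).
    have [mJ ms] := strip_exit_left nJ zs h1 z'r z'n.
    apply: (gate (n - 1)) => //; first by rewrite eqxx.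
    by apply/orP; right; rewrite z1 andbT ltW.
  have [z'n'|z'n'] := ltP (x (n + 1)) z'.1.
    have [mJ ms] := strip_exit_right nJ zs h1 z'r z'n'.
    apply: (gate (n + 1)) => //; first by rewrite eqxx orbT.
    by apply/orP; left; rewrite z2 ltW.
  (* In the same strip [g] is below the barrier, so [f] is above the term of gate [n]. *)
  have z's : in_strip n z' by rewrite /in_strip z'n z'n'.
  rewrite /lyapunov z'r.
  apply: le_trans (bigmin_le_mem _ _ _) _; first by rewrite mem_levels; exact: nJ.
  rewrite /= z's /f ler_pM2l// /level.
  have [_ /(_ (in_strip_ge z's)) gb _] := gloc _ _ (Xd _ _ h1) (Yd _ _ h2).
  by rewrite -/(X _) -/(Y _); lra.
Qed.

End lyapunov.

(** * Killed Gaussian walks *)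

Section gaussian_mass.
Context {R : realType} (s : R).
Hypothesis s_gt0 : 0 < s.
Local Notation nu := (normal_prob (0 : R) s).

Definition gauss_mass : R := (Num.sqrt (pi *+ 2))^-1 * expR (- 2).

Lemma gauss_mass_gt0 : 0 < gauss_mass.
Proof. by rewrite mulr_gt0 ?expR_gt0// invr_gt0 sqrtr_gt0 mulrn_wgt0// pi_gt0. Qed.

Lemma normal_prob_opp (A : set (measurableTypeR R)) : measurable A ->
  nu (-%R @^-1` A) = nu A.
Proof.
move=> mA; rewrite /normal_prob.
have mopp : measurable_fun [set: measurableTypeR R]
    (-%R : measurableTypeR R -> measurableTypeR R) by exact: oppr_measurable.
have mpdf : measurable_fun A (fun y : measurableTypeR R => (normal_pdf 0 s y)%:E).
  by apply/measurable_EFinP; apply: measurable_funTS; exact: measurable_normal_pdf.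
transitivity (\int[pushforward lebesgue_measure
    (-%R : measurableTypeR R -> measurableTypeR R)]_(y in A)
    (normal_pdf 0 s y)%:E)%E.
  rewrite ge0_integral_pushforward//; last first.
    by move=> y _; rewrite lee_fin normal_pdf_ge0.
  apply: eq_integral => y _ /=; congr (_%:E).
  rewrite normal_pdfE ?gt_eqF// /normal_fun.
  by congr (_ * expR _); rewrite !subr0 sqrrN.
apply: eq_measure_integral => B mB _.
exact: lebesgue_measureN.
Qed.

(** On the interval the density is at least its value at [2 * s], which is [gauss_mass / s];
    multiplied by the length [s], this no longer depends on [s]. *)
Lemma normal_prob_itv : (gauss_mass%:E <= nu `[s, (2 * s)%R]%classic)%E.
Proof.
have s0 : s != 0 by rewrite gt_eqF.
rewrite /normal_prob.
apply: (@le_trans _ _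
  (\int[lebesgue_measure]_(x in `[s, (2 * s)%R]) (gauss_mass / s)%:E)%E).
  rewrite integral_cst//= lebesgue_measure_itv/= lte_fin.
  rewrite (_ : s < 2 * s); last by rewrite mulr_natl mulr2n ltrDl.
  by rewrite -EFinB -EFinM lee_fin (_ : 2 * s - s = s) ?divfK//; lra.
apply: ge0_le_integral => //=.
- by move=> x _; rewrite lee_fin divr_ge0 ?(ltW gauss_mass_gt0)// ltW.
- by apply/measurable_EFinP; apply: measurable_funTS; exact: measurable_normal_pdf.
move=> x; rewrite in_itv/= => /andP[x1 x2]; rewrite lee_fin normal_pdfE//.
rewrite /gauss_mass mulrAC ler_pM ?expR_ge0 ?divr_ge0 ?invr_ge0 ?sqrtr_ge0 ?(ltW s_gt0)//.
- rewrite /normal_peak -mulrnAr sqrtrM ?sqr_ge0// sqrtr_sqr gtr0_norm// invfM.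
  by rewrite mulrC.
- rewrite ler_expR subr0 mulNr lerN2 ler_pdivrMr ?pmulrn_lgt0 ?exprn_gt0//.
  have -> : 2 * (s ^+ 2 *+ 2) = (2 * s) ^+ 2 by ring.
  by rewrite lerXn2r ?nnegrE//; lra.
Qed.

End gaussian_mass.

(** * Averaging over the symmetries of the square *)

Section symmetric_step.
Context {R : realType}.
Local Notation mR := (measurableTypeR R).
Variable nu : probability mR R.
Hypothesis nu_opp : forall A : set mR, measurable A -> nu (-%R @^-1` A) = nu A.
Local Notation nu2 := (nu \x nu)%E.

Let flip1 (h : mR * mR) : mR * mR := (- h.1, h.2).
Let flip2 (h : mR * mR) : mR * mR := (h.1, - h.2).
Let swap2 (h : mR * mR) : mR * mR := (h.2, h.1).

Let mflip1 : measurable_fun setT flip1.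
Proof.
apply: measurable_fun_pair => /=; last exact: measurable_snd.
by apply: measurableT_comp; [exact: oppr_measurable|exact: measurable_fst].
Qed.

Let mflip2 : measurable_fun setT flip2.
Proof.
apply: measurable_fun_pair => /=; first exact: measurable_fst.
by apply: measurableT_comp; [exact: oppr_measurable|exact: measurable_snd].
Qed.

Let mswap2 : measurable_fun setT swap2.
Proof. by apply: measurable_fun_pair; [exact: measurable_snd|exact: measurable_fst]. Qed.

(** A product measure is determined by its values on rectangles. *)
Let integral_invariant (phi : mR * mR -> mR * mR) (G : mR * mR -> \bar R) :
  measurable_fun setT phi ->
  (forall A B, measurable A -> measurable B ->
    nu2 (phi @^-1` (A `*` B)) = (nu A * nu B)%E) ->
  measurable_fun setT G -> (forall h, 0 <= G h)%E ->
  (\int[nu2]_h G (phi h) = \int[nu2]_h G h)%E.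
Proof.
move=> mphi inv mG G0.
transitivity (\int[pushforward nu2 phi]_h G h)%E.
  by rewrite ge0_integral_pushforward// preimage_setT.
apply: eq_measure_integral => A mA _; apply/esym.
exact: (@product_measure_unique _ _ _ _ R nu nu (pushforward nu2 phi)).
Qed.

Let mopp (A : set mR) : measurable A -> measurable (-%R @^-1` A).
Proof.
move=> mA; rewrite -[X in measurable X]setTI.
have := @oppr_measurable R setT measurableT _ mA.
exact.
Qed.

Let integral_flip1 (G : mR * mR -> \bar R) :
  measurable_fun setT G -> (forall h, 0 <= G h)%E ->
  (\int[nu2]_h G (- h.1, h.2)%R = \int[nu2]_h G h)%E.
Proof.
apply: (integral_invariant mflip1) => A B mA mB.
transitivity (nu (-%R @^-1` A) * nu B)%E; last by rewrite nu_opp.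
exact: (product_measure1E nu nu (mopp mA) mB).
Qed.

Let integral_flip2 (G : mR * mR -> \bar R) :
  measurable_fun setT G -> (forall h, 0 <= G h)%E ->
  (\int[nu2]_h G (h.1, - h.2)%R = \int[nu2]_h G h)%E.
Proof.
apply: (integral_invariant mflip2) => A B mA mB.
transitivity (nu A * nu (-%R @^-1` B))%E; last by rewrite nu_opp.
exact: (product_measure1E nu nu mA (mopp mB)).
Qed.

Let integral_swap (G : mR * mR -> \bar R) :
  measurable_fun setT G -> (forall h, 0 <= G h)%E ->
  (\int[nu2]_h G (h.2, h.1) = \int[nu2]_h G h)%E.
Proof.
apply: (integral_invariant mswap2) => A B mA mB.
rewrite (_ : _ @^-1` _ = B `*` A)//; last by apply/seteqP; split => -[u v] [].
by rewrite product_measure1E// muleC.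
Qed.

(** The integrals of [F] composed with the eight symmetries are equal, so eight times the integral
    of [F] is that of the eight-point sum. The gain [k * (a ^+ 2 + b ^+ 2)] is kept only on the
    square [E], where it is at least [k * s ^+ 2] and whose mass is at least [m ^+ 2]. *)
Lemma symmetric_step (s r k m M : R) (F : mR * mR -> R) :
  0 < s -> 2 * s <= r -> 0 <= k -> 0 <= m ->
  (m%:E <= nu `[s, (2 * s)%R]%classic)%E ->
  measurable_fun setT F ->
  (forall h, 0 <= F h) ->
  (forall h, ~~ ((`|h.1| <= r) && (`|h.2| <= r)) -> F h = 0) ->
  (forall a b, `|a| <= r -> `|b| <= r ->
    sum8 (fun a b => F (a, b)) a b + k * (a ^+ 2 + b ^+ 2) <= 8 * M) ->
  (\int[nu2]_h (F h)%:E <= (M - k * s ^+ 2 * m ^+ 2 / 8)%:E)%E.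
Proof.
move=> s0 sr k0 m0 mnu mF F0 Fout F8.
pose G h := (F h)%:E.
have mG : measurable_fun setT G by exact/measurable_EFinP.
have G0 h : (0 <= G h)%E by rewrite lee_fin.
have M0 : 0 <= M.
  have r0 : `|0 : R| <= r by rewrite normr0; lra.
  have := F8 0 0 r0 r0; rewrite /sum8 oppr0; have := F0 (0, 0); lra.
pose I : set mR := `[s, 2 * s]%classic.
pose E : set (mR * mR) := I `*` I.
have mI : measurable I by exact: measurable_itv.
have mE : measurable E by exact: measurableX.
have EE : (m ^+ 2)%:E%E = (m%:E * m%:E)%E by rewrite -EFinM.
have nuE : ((m ^+ 2)%:E <= nu2 E)%E.
  by rewrite product_measure1E// EE lee_pmul.
pose phi (i : bool * bool * bool) (h : mR * mR) : mR * mR :=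
  let h1 := if i.2 then swap2 h else h in
  let h2 := if i.1.2 then flip2 h1 else h1 in
  if i.1.1 then flip1 h2 else h2.
have mphi i : measurable_fun setT (phi i).
  by rewrite /phi; case: i => -[[] []] [] //=; repeat (apply: measurableT_comp => //).
have mGphi i : measurable_fun setT (fun h => G (phi i h)).
  exact: (measurableT_comp mG (mphi i)).
have iphi i : (\int[nu2]_h G (phi i h) = \int[nu2]_h G h)%E.
  have m1 := measurableT_comp mG mflip1; have m2 := measurableT_comp mG mflip2.
  have m12 := measurableT_comp m1 mflip2.
  rewrite /phi; case: i => -[[] []] [] //=.
  - exact: (etrans (integral_swap m12 (fun=> G0 _))
      (etrans (integral_flip2 m1 (fun=> G0 _)) (integral_flip1 mG G0))).
  - exact: (etrans (integral_flip2 m1 (fun=> G0 _)) (integral_flip1 mG G0)).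
  - exact: (etrans (integral_swap m1 (fun=> G0 _)) (integral_flip1 mG G0)).
  - exact: (integral_flip1 mG G0).
  - exact: (etrans (integral_swap m2 (fun=> G0 _)) (integral_flip2 mG G0)).
  - exact: (integral_flip2 mG G0).
  - exact: (integral_swap mG G0).
pose s8 : seq (bool * bool * bool) :=
  [:: (false, false, false); (true, false, false); (false, true, false);
      (true, true, false);
      (false, false, true); (true, false, true); (false, true, true); (true, true, true)].
have mE1 : measurable_fun [set: mR * mR] (fun h => (k * s ^+ 2 * \1_E h)%:E).
  by apply/measurable_EFinP; apply: measurable_funM => //; exact: measurable_indic.
have ks0 : 0 <= k * s ^+ 2 by rewrite mulr_ge0 ?sqr_ge0.
have nu2T : nu2 [set: mR * mR] = 1%E.
  rewrite -setXTT; transitivity (nu setT * nu setT)%E.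
    exact: (product_measure1E nu nu measurableT measurableT).
  by rewrite probability_setT mule1.
have key : (\int[nu2]_h (\sum_(i <- s8) G (phi i h) +
    (k * s ^+ 2 * \1_E h)%:E) <= (8 * M)%:E)%E.
  apply: (@le_trans _ _ (\int[nu2]_(_ in [set: mR * mR]) (8 * M)%:E)%E); last first.
    by rewrite integral_cst// [X in (_ * X)%E](_ : _ = 1%E) ?mule1.
  apply: ge0_le_integral => //.
  - by move=> h _; rewrite adde_ge0 ?sume_ge0// lee_fin mulr_ge0.
  - by apply: emeasurable_funD => //; exact: emeasurable_sum.
  - move=> [a b] _; rewrite /s8 !big_cons big_nil /G /phi /= -!EFinD lee_fin.
    have [/andP[ha hb]|] := boolP ((`|a| <= r) && (`|b| <= r)).
      apply: le_trans (F8 a b ha hb); rewrite /sum8 /flip1 /flip2 /swap2 /=.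
      have : k * s ^+ 2 * \1_E (a, b) <= k * (a ^+ 2 + b ^+ 2).
        rewrite -mulrA ler_wpM2l// indicE.
        have [|_] := boolP ((a, b) \in E); last by rewrite mulr0 addr_ge0 ?sqr_ge0.
        rewrite inE => -[] /=; rewrite /I /= !in_itv/= => /andP[a1 _] _.
        rewrite mulr1 -[leLHS]addr0 lerD ?sqr_ge0//.
        by rewrite lerXn2r ?nnegrE//; lra.
      lra.
    (* Outside the box of half-side [r] all eight terms vanish, and so does the indicator of [E],
       because [2 * s <= r]. *)
    move=> out.
    rewrite /flip1 /flip2 /swap2 !Fout /= ?normrN ?[(`|b| <= r) && _]andbC//.
    rewrite indicE memNset ?mulr0 ?addr0 ?mulr_ge0//.
    move=> [] /=; rewrite /I /= !in_itv/= => /andP[a1 a2] /andP[b1 b2].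
    by move/negP: out; apply; rewrite !ger0_norm; lra.
have iE : (\int[nu2]_h (k * s ^+ 2 * \1_E h)%:E = (k * s ^+ 2)%:E * nu2 E)%E.
  under eq_integral do rewrite EFinM.
  rewrite ge0_integralZl_EFin//; first by rewrite integral_indic// setIT.
  by apply/measurable_EFinP; exact: measurable_indic.
rewrite ge0_integralD// in key; first last.
- by move=> h _; rewrite lee_fin mulr_ge0.
- exact: emeasurable_sum.
- by move=> h _; exact: sume_ge0.
rewrite ge0_integral_sum// iE in key.
rewrite (eq_bigr _ (fun i _ => iphi i)) in key.
rewrite /s8 !big_cons big_nil in key.
have I0 : (0 <= \int[nu2]_h G h)%E by exact: integral_ge0.
have {}key : ((\int[nu2]_h G h + \int[nu2]_h G h + \int[nu2]_h G h +
    \int[nu2]_h G h + \int[nu2]_h G h + \int[nu2]_h G h + \int[nu2]_h G h +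
    \int[nu2]_h G h) + (k * s ^+ 2 * m ^+ 2)%:E <= (8 * M)%:E)%E.
  apply: le_trans key; rewrite adde0 !addeA leeD2l//.
  by rewrite (EFinM (k * s ^+ 2)) lee_wpmul2l.
move: key I0; rewrite -/(G _); case: (\int[nu2]_h G h)%E => [v| |]//.
rewrite -!EFinD !lee_fin => key _.
by lra.
Qed.

End symmetric_step.

(** * Independence of an increment from the past *)

Section independent_history.
Context {R : realType} {d d' : measure_display} {T : measurableType d}
  {U : measurableType d'}.
Variables (P : probability T R) (X : nat -> T -> U).
Hypothesis mX : forall i, measurable_fun setT (X i).
Hypothesis indepX :
  forall n, mutually_independent P (fun i : 'I_n => X i).

(** The cylinders over the first [k] variables, a pi-system generating the past. *)
Definition history (k : nat) : set (set T) :=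
  [set E | exists2 A : nat -> set U, (forall i, measurable (A i)) &
     E = \bigcap_(i in `I_k) X i @^-1` A i].

Lemma measurable_preim i (B : set U) : measurable B -> measurable (X i @^-1` B).
Proof. by move=> mB; rewrite -[X in measurable X]setTI; exact: mX. Qed.

Lemma setI_closed_history k : setI_closed (history k).
Proof.
move=> _ _ [A mA ->] [B mB ->]; exists (fun i => A i `&` B i).
  by move=> i; exact: measurableI.
by apply/seteqP; split => t; [move=> [At Bt] i ik; split; [exact: At|exact: Bt]|
  move=> AB; split=> i ik; have [] := AB i ik].
Qed.

Lemma measurable_history k E : history k E -> measurable E.
Proof.
move=> [A mA ->]; apply: bigcap_measurableType => i _.
exact: measurable_preim.
Qed.

Lemma measurable_sigma_history k E : <<s history k >> E -> measurable E.
Proof.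
move: E; apply: smallest_sub => [|E]; last exact: measurable_history.
exact: sigma_algebra_measurable.
Qed.

Lemma probability_history (A : nat -> set U) k :
  (forall i, measurable (A i)) ->
  P (\bigcap_(i in `I_k) X i @^-1` A i) = (\prod_(i < k) P (X i @^-1` A i))%E.
Proof.
move=> mA; have := @indepX k (fun i => A i) (fun i => mA i); move=> <-.
congr (P _); apply/seteqP; split => t Ht i; first by move=> _; exact: (Ht _ (ltn_ord i)).
by move=> ik; exact: (Ht (Ordinal ik)).
Qed.

(** Dynkin's pi-lambda theorem: the events satisfying the product rule form a lambda-system, and for
    a cylinder the rule follows from [probability_history] at [k] and [k.+1]. *)
Lemma history_indep k (E : set T) (B : set U) : <<s history k >> E ->
  measurable B -> P (E `&` X k @^-1` B) = (P E * P (X k @^-1` B))%E.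
Proof.
move=> sE mB; have mXB := measurable_preim k mB.
pose H := [set E | measurable E /\ P (E `&` X k @^-1` B) = (P E * P (X k @^-1` B))%E].
suff : <<s history k >> `<=` H by move=> /(_ _ sE)[].
apply: lambda_system_subset; [exact: setI_closed_history| | |by []].
- apply/dynkin_lambda_system; split.
  + by split => //; rewrite setTI probability_setT mul1e.
  + move=> A [mA HA]; split; first exact: measurableC.
    have -> : P (~` A `&` X k @^-1` B) = (P (X k @^-1` B) - P (A `&` X k @^-1` B))%E.
      rewrite setIC -setDE measureD//; last by rewrite ltey_eq fin_num_measure.
      by rewrite [X in (_ - X)%E](_ : _ = P (A `&` X k @^-1` B))// setIC.
    rewrite HA probability_setC//.
    rewrite -(fineK (fin_num_measure P _ mA)) -(fineK (fin_num_measure P _ mXB)).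
    by rewrite -[1%E]/(1%:E) -!(EFinB, EFinM); congr (_%:E); ring.
  + move=> F tF HF; have mF n : measurable (F n) by have [] := HF n.
    split; first exact: bigcup_measurable.
    rewrite setI_bigcupl !measure_bigcup//.
    * rewrite muleC -(fineK (fin_num_measure P _ mXB)) -nneseriesZl//.
      by apply: eq_eseriesr => n _; rewrite fineK ?fin_num_measure// muleC;
        have [] := HF n.
    * by move=> n _; exact: measurableI.
    * exact: trivIset_setIr.
- move=> _ [A mA ->]; split; first by apply: (@measurable_history k); exists A.
  pose A' i := if (i < k)%N then A i else B.
  have mA' i : measurable (A' i) by rewrite /A'; case: ifP.
  have A'k : A' k = B by rewrite /A' ltnn.
  have := probability_history k.+1 mA'.
  rewrite big_ord_recr/= A'k => E'.
  transitivity (P (\bigcap_(i in `I_k.+1) X i @^-1` A' i)).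
    congr (P _); apply/seteqP; split => t.
      move=> [At Bt] i; rewrite /= ltnS leq_eqVlt /A' => /predU1P[->|ik].
        by rewrite ltnn.
      by rewrite ik; exact: At.
    move=> At; split; last by have := At k (ltnSn _); rewrite /A' ltnn.
    by move=> i /= ik; have := At i (ltnW ik); rewrite /A' ik.
  rewrite E' (probability_history k mA); congr (_ * _)%E.
  by apply: eq_bigr => i _; rewrite /A' ltn_ord.
Qed.

End independent_history.

Section independent_integral.
Context {R : realType} {d d1 d2 : measure_display} {T : measurableType d}
  {U1 : measurableType d1} {U2 : measurableType d2}.
Variables (P : probability T R) (Q : {sigma_finite_measure set U2 -> \bar R}).
Local Open Scope ereal_scope.

(** The joint law of [(Y, X)] agrees on rectangles with the product of the law of [Y] and [Q], hence
    everywhere; Tonelli's theorem concludes. *)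
Lemma independent_integral (Y : T -> U1) (X : T -> U2) (f : U1 * U2 -> \bar R) :
  measurable_fun setT Y -> measurable_fun setT X ->
  (forall A B, measurable A -> measurable B ->
    P (Y @^-1` A `&` X @^-1` B) = P (Y @^-1` A) * Q B) ->
  measurable_fun setT f -> (forall u, 0 <= f u) ->
  \int[P]_w f (Y w, X w) = \int[P]_w \int[Q]_h f (Y w, h).
Proof.
move=> mY mX indep mf f0.
pose Y' : {mfun T >-> U1} := HB.pack Y (isMeasurableFun.Build _ _ _ _ _ mY).
have mYX : measurable_fun setT (fun w => (Y w, X w)) by exact: measurable_fun_pair.
transitivity (\int[pushforward P (fun w => (Y w, X w))]_u f u).
  by rewrite ge0_integral_pushforward// preimage_setT.
transitivity (\int[distribution P Y' \x Q]_u f u).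
  apply: eq_measure_integral => A mA _; apply/esym.
  apply: (@product_measure_unique _ _ _ _ R (distribution P Y') Q
    (pushforward P (fun w => (Y w, X w)))) => //.
rewrite fubini_tonelli1// ge0_integral_distribution//.
- exact: measurable_fun_fubini_tonelli_F.
- by move=> y; exact: integral_ge0.
Qed.

End independent_integral.

(** * A supermartingale for the killed walk *)

Section walk.
Context {R : realType} {d : measure_display} {T : measurableType d}.
Variables (P : probability T R) (z0 : R * R) (W : nat -> T -> R * R).
Let X i : T -> R * R := fun w => W i.+1 w - W i w.
(* Gaussian measures live on [measurableTypeR R], whose display differs from the
   one of the canonical measurable structure of [R]; the measurable sets agree. *)
Variable Q : {sigma_finite_measure
  set (measurableTypeR R * measurableTypeR R)%type -> \bar R}.
Hypothesis W0 : forall w, W 0 w = z0.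
Hypothesis mX : forall i, measurable_fun setT (X i).
Hypothesis indepX : forall n, mutually_independent P (fun i : 'I_n => X i).
Hypothesis lawX : forall i B, measurable B -> P (X i @^-1` B) = Q B.

Variables (ran : R * R -> bool) (adm : (R * R) * (R * R) -> bool).
Hypothesis mran : measurable_fun setT ran.
Hypothesis madm : measurable_fun setT adm.

(** Giving [T] the sigma-algebra of the first [k] increments makes adaptedness an ordinary
    measurability statement. *)
Let past k : Type := g_sigma_algebraType (history X k).

Let past_X k i : (i < k)%N -> measurable_fun [set: past k] (X i : past k -> R * R).
Proof.
move=> ik _ B mB; rewrite setTI; apply: sub_sigma_algebra.
exists (fun j => if j == i then B else setT); first by move=> j; case: ifP.
apply/seteqP; split => t /=; first by move=> Bt j jk /=; case: eqP => // ->.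
by move=> /(_ i ik) /=; rewrite eqxx.
Qed.

Let measurable_addR2 d' (T' : measurableType d') (f g : T' -> R * R) :
  measurable_fun setT f -> measurable_fun setT g ->
  measurable_fun setT (fun t => f t + g t).
Proof.
move=> mf mg; apply: measurable_fun_pair => /=; apply: measurable_funD;
by [exact: measurableT_comp measurable_fst _|exact: measurableT_comp measurable_snd _].
Qed.

Let past_W k i : (i <= k)%N -> measurable_fun [set: past k] (W i : past k -> R * R).
Proof.
elim: i => [_|i IH ik].
  rewrite (_ : W 0 = cst z0); first exact: measurable_cst.
  by apply/funext => w; rewrite W0.
rewrite (_ : W i.+1 = (fun w => W i w + X i w)).
  by apply: measurable_addR2; [exact: IH (ltnW ik)|exact: past_X].
by apply/funext => w; rewrite /X addrC subrK.
Qed.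

Fixpoint ongoing (k : nat) (w : T) : bool :=
  if k is k'.+1 then [&& ongoing k' w, ran (W k' w) & adm (W k' w, W k'.+1 w)]
  else true.

Let past_ongoing k i : (i <= k)%N ->
  measurable_fun [set: past k] (ongoing i : past k -> bool).
Proof.
elim: i => [_|i IH ik] /=; first exact: measurable_cst.
have m1 := past_W (ltnW ik); have m2 := past_W ik.
apply: measurable_and; first exact: IH (ltnW ik).
apply: measurable_and; first exact: (measurableT_comp mran m1).
exact: (measurableT_comp madm (measurable_fun_pair m1 m2)).
Qed.

Let past_measurable k d' (V : measurableType d') (f : T -> V) :
  measurable_fun [set: past k] (f : past k -> V) -> measurable_fun setT f.
Proof.
move=> mf _ B mB; rewrite setTI; apply: (measurable_sigma_history mX (k := k)).
by have := mf measurableT _ mB; rewrite setTI.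
Qed.

Fixpoint stopped (k : nat) (w : T) : bool :=
  if k is k'.+1 then stopped k' w || (ongoing k' w && ~~ ran (W k' w))
  else false.

Let mW k : measurable_fun setT (W k).
Proof. exact: past_measurable (past_W (leqnn k)). Qed.

Let mongoing k : measurable_fun setT (ongoing k).
Proof. exact: past_measurable (past_ongoing (leqnn k)). Qed.

Let mstopped k : measurable_fun setT (stopped k).
Proof.
elim: k => [|k IH] /=; first exact: measurable_cst.
apply: measurable_or => //; apply: measurable_and => //; apply: measurable_neg.
exact: measurableT_comp.
Qed.

Variables (N : nat) (Psi : nat -> R * R -> R).
Hypothesis mPsi : forall k, measurable_fun setT (Psi k).
Hypothesis Psi_ge0 : forall k z, 0 <= Psi k z.
Hypothesis Psi_exit : forall k z, ~~ ran z -> 1 <= Psi k z.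
Hypothesis Psi_end : forall z, 1 <= Psi N z.
Hypothesis Psi_step : forall k z, (k < N)%N -> ran z ->
  (\int[Q]_h (if adm (z, z + h)%R then (Psi k.+1 (z + h)%R)%:E else 0) <=
   (Psi k z)%:E)%E.

Local Open Scope ereal_scope.

Let V k w : \bar R :=
  (if stopped k w then 1 else 0) + (if ongoing k w then (Psi k (W k w))%:E else 0).

Let V_ge0 k w : 0 <= V k w.
Proof. by rewrite /V adde_ge0//; case: ifP => // _; rewrite lee_fin. Qed.

Let mV k : measurable_fun setT (V k).
Proof.
apply: emeasurable_funD; apply: measurable_fun_ifT => //.
by apply/measurable_EFinP; exact: measurableT_comp.
Qed.

(** The last increment is integrated out given the past: [Psi_step] handles the paths still in
    range, [Psi_exit] those just found out of it, and inadmissible steps only lose mass. *)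
Let V_step k : (k < N)%N -> \int[P]_w V k.+1 w <= \int[P]_w V k w.
Proof.
move=> kN.
pose Y w := (ongoing k w, W k w).
(* The sum of [A] and [f] bounds [V k.+1]; [A] is known at time [k], and only [f] involves the
   increment [X k]. *)
pose A w : \bar R := (if stopped k w then 1 else 0) +
  (if ongoing k w && ~~ ran (W k w) then 1 else 0).
pose f (u : (bool * (R * R)) * (R * R)) : \bar R :=
  if [&& u.1.1, ran u.1.2 & adm (u.1.2, u.1.2 + u.2)%R]
  then (Psi k.+1 (u.1.2 + u.2)%R)%:E else 0.
have mu12 : measurable_fun setT (fun u : (bool * (R * R)) * (R * R) => u.1.2).
  by apply: measurableT_comp => //; exact: measurable_snd.
have mu : measurable_fun setT
    (fun u : (bool * (R * R)) * (R * R) => (u.1.2 + u.2)%R).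
  by apply: measurable_addR2 => //; exact: measurable_snd.
have mf : measurable_fun setT f.
  apply: measurable_fun_ifT => //.
    apply: measurable_and; first by apply: measurableT_comp => //; exact: measurable_fst.
    apply: measurable_and; first exact: measurableT_comp.
    by apply: measurableT_comp => //; exact: measurable_fun_pair.
  by apply/measurable_EFinP; exact: measurableT_comp.
have f0 u : 0 <= f u by rewrite /f; case: ifP => // _; rewrite lee_fin.
have mA : measurable_fun setT A.
  apply: emeasurable_funD; apply: measurable_fun_ifT => //.
  apply: measurable_and => //; apply: measurable_neg; exact: measurableT_comp.
have A0 w : 0 <= A w by rewrite /A adde_ge0//; case: ifP.
have mY : measurable_fun setT Y by exact: measurable_fun_pair.
have mfYX : measurable_fun setT (fun w => f (Y w, X k w)).
  by apply: measurableT_comp => //; exact: measurable_fun_pair.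
have minner : measurable_fun setT (fun w => \int[Q]_h f (Y w, h)).
  have mF := measurable_fun_fubini_tonelli_F (m2 := Q) f mf f0.
  rewrite (_ : (fun w => _) = fubini_F Q f \o Y)//.
  exact: (measurableT_comp mF mY).
have inner0 w : 0 <= \int[Q]_h f (Y w, h) by exact: integral_ge0.
apply: (@le_trans _ _ (\int[P]_w (A w + f (Y w, X k w)))).
  apply: ge0_le_integral => //; first exact: emeasurable_funD.
  move=> w _; have WX : (W k w + X k w = W k.+1 w)%R by rewrite /X addrC subrK.
  rewrite /V /A /f /Y /= WX.
  by case: (stopped k w); case: (ongoing k w); case: (ran (W k w)) => //=;
    rewrite ?adde0 ?add0e ?leeDl.
rewrite ge0_integralD// (independent_integral (Q := Q) mY (mX k) _ mf f0); last first.
  move=> B C mB mC; rewrite (history_indep mX indepX _ mC) ?lawX//.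
  have mY' : measurable_fun [set: past k] (Y : past k -> _).
    by apply: measurable_fun_pair; [exact: past_ongoing|exact: past_W].
  by have := mY' measurableT _ mB; rewrite setTI.
rewrite -ge0_integralD//.
apply: ge0_le_integral => //.
- by move=> w _; rewrite adde_ge0.
- exact: emeasurable_funD.
- move=> w _; rewrite /A /V -addeA leeD2l// /f /Y /=.
  have [ow|_] := boolP (ongoing k w); last by rewrite /= integral0 add0e.
  have [rw|nrw] := boolP (ran (W k w)); rewrite /=.
    by rewrite add0e; exact: Psi_step.
  by rewrite integral0 adde0 lee_fin Psi_exit.
Qed.

(** If all steps are admissible, the path is stopped or ongoing at time [N], so that [V N] is at
    least 1 there; the expectation of [V] does not increase from its initial value [Psi 0 z0]. *)
Lemma walk_bound :
  P [set w | forall k, (k < N)%N -> adm (W k w, W k.+1 w)] <= (Psi 0 z0)%:E.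
Proof.
have mono k : (k <= N)%N -> \int[P]_w V k w <= (Psi 0 z0)%:E.
  elim: k => [_|k IH kN]; last exact: le_trans (V_step kN) (IH (ltnW kN)).
  under eq_integral do rewrite /V /= add0e W0.
  by rewrite integral_cst// [X in _ * X](_ : _ = 1) ?mule1//; exact: probability_setT.
set D := [set w | _].
have mD : measurable D.
  rewrite (_ : D = \bigcap_(k in `I_N) (fun w => adm (W k w, W k.+1 w)) @^-1` [set true]).
    apply: bigcap_measurableType => k _; rewrite -[X in measurable X]setTI.
    have mWW : measurable_fun setT (fun w => adm (W k w, W k.+1 w)).
      by apply: measurableT_comp => //; exact: measurable_fun_pair.
    exact: mWW.
  by apply/seteqP; split.
apply: le_trans (mono N (leqnn N)).
have -> : P D = \int[P]_w (\1_D w)%:E by rewrite integral_indic// setIT.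
apply: ge0_le_integral => //.
- by apply/measurable_EFinP; exact: measurable_indic.
- move=> w _; rewrite indicE; have [|_] := boolP (w \in D); last exact: V_ge0.
  rewrite inE => Dw.
  have so k : (k <= N)%N -> stopped k w || ongoing k w.
    elim: k => // k IH kN /=; have := IH (ltnW kN).
    rewrite (Dw k kN) andbT; case: (stopped k w) => //= ->.
    by case: (ran _).
  have := so N (leqnn N); rewrite /V; case: (stopped N w) => /= [_|->].
    by rewrite leeDl//; case: ifP => // _; rewrite lee_fin.
  by rewrite add0e lee_fin.
Qed.

End walk.

(** * Survival of the Brownian motion *)

Section paths.
Context {R : realType}.

(** Compactness of [[0, T]] in its near-covering form; the time [s] may exceed [T]. *)
Lemma uniform_continuity_halfline (f : R -> R) (T r : R) :
  {within `[0, +oo[, continuous f} -> 0 < r -> exists2 eta, 0 < eta &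
    forall s t, 0 <= s -> 0 <= t <= T -> `|s - t| <= eta -> `|f s - f t| <= r.
Proof.
move=> /subspace_continuousP cf r0.
pose Pr (eta t : R) := forall s, 0 <= s -> `|s - t| <= eta -> `|f s - f t| <= r.
have /compact_near_coveringP/near_covering_withinP cov := @segment_compact R 0 T.
have near_eta : \forall eta \near (0 : R)^'+, `[0, T]%classic `<=` Pr eta.
  apply: cov.
  move=> t /= t0T.
  have t0 : `[0, +oo[%classic t by move: t0T; rewrite /= !in_itv/= andbT => /andP[].
  have /cvgrPdist_le/(_ (r / 2)) := cf t t0.
  rewrite divr_gt0// => /(_ isT); rewrite near_withinE => -[e /= e0 he].
  have e20 : 0 < e / 2 by rewrite divr_gt0.
  exists (ball t (e / 2), [set eta | 0 < eta < e / 2]).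
    split => /=; first exact: nbhsx_ballx.
    by near=> eta; apply/andP; split; near: eta;
      [exact: nbhs_right_gt|exact: nbhs_right_lt].
  move=> [t' eta] /= [bt /andP[eta0 eta1]] t'0T s s0 st.
  have t'0 : 0 <= t' by move: t'0T; rewrite in_itv/= => /andP[].
  rewrite /ball/= in bt.
  have h1 := he t' _ _; have h2 := he s _ _.
  have b1 : `|t - t'| < e by lra.
  have b2 : `|t - s| < e.
    rewrite (le_lt_trans (ler_distD t' _ _))// [e](splitr) ltr_leD// distrC.
    lra.
  have k1 := h1 b1; have k2 := h2 b2.
  rewrite !in_itv/= !andbT in k1 k2.
  have := k1 t'0; have := k2 s0 => q2 q1.
  rewrite (le_trans (ler_distD (f t) _ _))// [r]splitr lerD// distrC//.
have [eta [eta0 h]] : exists eta, 0 < eta /\ `[0, T]%classic `<=` Pr eta.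
  apply: (@filter_ex _ (0 : R)^'+); near=> eta; split; near: eta => //.
  exact: nbhs_right_gt.
exists eta => // s t s0 t0T; exact: (h t).
Unshelve. all: by end_near.
Qed.

Lemma continuous_fst_path (Z : R -> R * R) (A : set R) :
  {within A, continuous Z} -> {within A, continuous (fun t => (Z t).1)}.
Proof.
by move=> cZ t; exact: (cvg_comp _ _ (cZ t) (@cvg_fst _ _ _ _ _)).
Qed.

Lemma continuous_snd_path (Z : R -> R * R) (A : set R) :
  {within A, continuous Z} -> {within A, continuous (fun t => (Z t).2)}.
Proof.
by move=> cZ t; exact: (cvg_comp _ _ (cZ t) (@cvg_snd _ _ _ _ _)).
Qed.

(** If the abscissas at the two ends of a step enclose gate [m], the intermediate value theorem
    gives a time in between when the path is on that gate, hence in its hole; uniform continuity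
    carries the height bound to the end of the step. The threshold [M] depends on the path. *)
Lemma surviving_path_admissible (x b : int -> R) (J : nat) (r T : R) (Z : R -> R * R) :
  0 < r -> 0 < T -> {within `[0, +oo[, continuous Z} ->
  (forall t, 0 <= t <= T -> comb_domain x b (Z t)) ->
  exists M : nat, forall N, (M <= N)%N -> forall k, (k < N.+1)%N ->
    admissible x b J r (Z (k%:R * (T / N.+1%:R))) (Z (k.+1%:R * (T / N.+1%:R))).
Proof.
move=> r0 T0 cZ alive.
have c1 := continuous_fst_path cZ; have c2 := continuous_snd_path cZ.
have [e1 e10 h1] := uniform_continuity_halfline T c1 r0.
have [e2 e20 h2] := uniform_continuity_halfline T c2 r0.
have e0 : 0 < Num.min e1 e2 by rewrite lt_min e10.
have [M hM] : exists M : nat, forall N, (M <= N)%N -> T / N.+1%:R <= Num.min e1 e2.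
  exists (Num.truncn (T / Num.min e1 e2)) => N MN.
  rewrite ler_pdivrMr// mulrC -ler_pdivrMr// (le_trans (ltW (truncnS_gt _)))//.
  by rewrite ler_nat.
exists M => N MN k kN; set dt := T / N.+1%:R.
have dt0 : 0 < dt by rewrite divr_gt0.
set s := k%:R * dt; set t := k.+1%:R * dt.
have st : t = s + dt by rewrite /t /s -natr1 mulrDl mul1r.
have s0 : 0 <= s by rewrite mulr_ge0// ltW.
have tT : t <= T.
  by rewrite /t /dt mulrCA ler_piMr ?(ltW T0)// ler_pdivrMr// mul1r ler_nat.
have dte := hM N MN; rewrite -/dt le_min in dte; have [dt1 dt2] := andP dte.
apply/and3P; split.
- by apply: h1; [lra|apply/andP; split; lra|rewrite ger0_norm; lra].
- by apply: h2; [lra|apply/andP; split; lra|rewrite ger0_norm; lra].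
apply/allP => m _; apply/implyP => cross.
have [u uI ux] : exists2 u, u \in `[s, t] & (Z u).1 = x m.
  apply: IVT; first lra.
    apply: continuous_subspaceW c1 => v /=; rewrite !in_itv/= andbT => /andP[v1 _].
    exact: le_trans v1.
  by rewrite ge_min le_max; case/orP: cross => /andP[-> ->]; rewrite ?orbT.
move: uI; rewrite in_itv/= => /andP[u1 u2].
have uT : 0 <= u <= T by apply/andP; split; lra.
have yu : `|(Z u).2| <= b m.
  rewrite leNgt; apply/negP => bu; apply: (alive u uT); exists m => //.
  split; first exact: ux.
  rewrite /= !in_itv/= andbT.
  have [y0|y0] := leP 0 (Z u).2; first by left; rewrite ltW// -(ger0_norm y0).
  by right; rewrite lerNr -(ltr0_norm y0) ltW.
have : `|(Z t).2 - (Z u).2| <= r.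
  by apply: h2 => //; [lra|rewrite ger0_norm; lra].
move=> tu; rewrite -[(Z t).2](subrK (Z u).2) (le_trans (ler_normD _ _))//.
by rewrite addrC lerD.
Qed.

End paths.

Section survival.
Context {R : realType} (l : R) (x b : int -> R) (J : nat) (r : R).
Hypothesis l0 : 0 < l.
Hypothesis x_mono : {homo x : m n / m < n}.
Hypothesis b_ub : forall n, Num.max (b (n - 1)) (b (n + 1)) <= l * width x n.
Hypothesis r_gt0 : 0 < r.
Hypothesis r_ub : forall n, (`|n| < J)%N -> r <= width x n / 20.

Local Notation lyap := (lyapunov l x J).
Local Notation mR := (measurableTypeR R).

(** Decay per unit of time: by [symmetric_step], an increment of variance [s ^+ 2] multiplies the
    mean of the killed Lyapunov function by at most [1 - rate * s ^+ 2]. *)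
Definition rate : R := 4 * leak l / max_gap_sq x J * gauss_mass ^+ 2 / 8.

Lemma leak_gt0 : 0 < leak l.
Proof. by have /andP[k0 _] := scale_bounds l0; rewrite /leak divr_gt0. Qed.

Lemma rate_gt0 : 0 < rate.
Proof.
rewrite /rate; apply: divr_gt0 => //.
apply: mulr_gt0; last by rewrite exprn_gt0 ?gauss_mass_gt0.
by rewrite divr_gt0 ?max_gap_sq_gt0// mulr_gt0// leak_gt0.
Qed.

Lemma lyapunov_ge z : 1 / 4 <= lyap z.
Proof.
have [zr|zr] := boolP (in_range x J z).
  by have [f []] := lyapunov_step x_mono l0 b_ub r_gt0 r_ub zr.
rewrite /lyapunov (negbTE zr) ler_pM2r// exprn_ege1// ltW//.
exact: growth_gt1.
Qed.

Lemma lyapunov_gt0 z : 0 < lyap z.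
Proof. by apply: lt_le_trans (lyapunov_ge z). Qed.

Lemma measurable_killed_lyapunov z : measurable_fun [set: R * R]
  (fun h => if admissible x b J r z (z + h) then (lyap (z + h))%:E else 0%E).
Proof.
have mzh : measurable_fun [set: R * R] (fun h => z + h)%R.
  apply: measurable_fun_pair => /=; apply: measurable_funD => //.
apply: measurable_fun_ifT => //.
  have mp : measurable_fun [set: R * R] (fun h => (z, z + h)%R).
    exact: measurable_fun_pair.
  exact: (measurableT_comp (measurable_admissible x b J r) mp).
apply/measurable_EFinP; apply: measurableT_comp => //.
exact: measurable_lyapunov.
Qed.

(** The killed function is below the majorant [f] of [lyapunov_step], cut to 0 outside the box of
    half-side [r]; [symmetric_step] applies to the latter. *)
Lemma lyapunov_gauss_step (s : R) z : 0 < s -> 2 * s <= r -> in_range x J z ->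
  (\int[normal_prob (0 : R) s \x normal_prob (0 : R) s]_h
     (if admissible x b J r z (z + h)%R then (lyap (z + h)%R)%:E else 0) <=
   (lyap z * expR (- (rate * s ^+ 2)))%:E)%E.
Proof.
move=> s0 sr zr.
have [f [mf fz V0 f8 floc]] := lyapunov_step x_mono l0 b_ub r_gt0 r_ub zr.
pose F (h : mR * mR) : R := if (`|h.1| <= r) && (`|h.2| <= r) then f (z + h)%R else 0.
have mzh : measurable_fun [set: R * R] (fun h => z + h)%R.
  apply: measurable_fun_pair => /=; apply: measurable_funD => //.
have mF : measurable_fun [set: R * R] (F : R * R -> R).
  apply: measurable_fun_ifT => //; last exact: measurableT_comp.
  by apply: measurable_and; apply: measurable_fun_ler => //; exact: measurableT_comp.
have F0 h : 0 <= F h.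
  rewrite /F; case: ifPn => // /andP[h1 h2].
  by have [] := floc (z + h)%R; rewrite /= ?[z.1 + _]addrC ?[z.2 + _]addrC ?addrK.
have sz0 : 0 <= lyap z * (4 * leak l / max_gap_sq x J).
  rewrite mulr_ge0 ?(ltW (lyapunov_gt0 _))// divr_ge0 ?(ltW (max_gap_sq_gt0 _ _))//.
  by rewrite mulr_ge0// ltW// leak_gt0.
apply: (@le_trans _ _ (\int[normal_prob (0 : R) s \x
    normal_prob (0 : R) s]_h (F h)%:E)%E).
  apply: ge0_le_integral => //.
  - by move=> h _; case: ifP => // _; rewrite lee_fin ltW// lyapunov_gt0.
  - exact: measurable_killed_lyapunov.
  - exact/measurable_EFinP.
  - move=> h _; case: ifPn => [adm|_]; last by rewrite lee_fin.
    rewrite lee_fin /F.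
    have [h1 h2 _] := and3P adm.
    have [_ /(_ adm)] := floc _ h1 h2.
    by move: h1 h2; rewrite /= ![_ + _ - _]addrAC !subrr !add0r => -> ->.
apply: le_trans (@symmetric_step R (normal_prob (0 : R) s) (normal_prob_opp s0) s r
  (lyap z * (4 * leak l / max_gap_sq x J)) gauss_mass (lyap z) F s0 sr sz0
  (ltW gauss_mass_gt0) (normal_prob_itv s0) mF F0 _ _) _.
- by move=> h hout; rewrite /F (negbTE hout).
- move=> a c ha hc; apply: le_trans (f8 a c ha hc).
  rewrite lerD2r /sum8 /F /= !normrN ha hc /=.
  by [].
rewrite lee_fin.
have e1 := expR_ge1Dx (- (rate * s ^+ 2)).
have := ler_wpM2l (ltW (lyapunov_gt0 z)) e1; apply: le_trans.
rewrite le_eqVlt; apply/orP; left; apply/eqP; rewrite /rate mulrBr mulr1; congr (_ - _).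
by move: (lyap z) (max_gap_sq x J)^-1 => ? ?; field.
Qed.

Section survival_bound.
Context {d : measure_display} {T : measurableType d} (P : probability T R).
Variables (z0 : R * R) (Z : R -> T -> R * R).
Hypothesis BM : standard_planar_BM P z0 Z.

Lemma survival_bound (t : R) (N : nat) : 0 < t ->
  2 * Num.sqrt (t / N.+1%:R) <= r ->
  (P [set w | forall k, (k < N.+1)%N ->
       admissible x b J r (Z (k%:R * (t / N.+1%:R)) w)
         (Z (k.+1%:R * (t / N.+1%:R)) w)] <=
   (lyap z0 * (4 / growth l ^+ J.-1 + 4 * expR (- (rate * t))))%:E)%E.
Proof.
move=> t0 sr; set dt := t / N.+1%:R; set s := Num.sqrt dt.
have dt0 : 0 < dt by rewrite divr_gt0.
have s0 : 0 < s by rewrite sqrtr_gt0.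
have s2 : s ^+ 2 = dt by rewrite sqr_sqrtr// ltW.
have mu0 : 0 < growth l by rewrite (lt_trans ltr01)// growth_gt1.
(* The first term makes [lyap z * C k] at least 1 out of range, where [lyap z] is
   [growth l ^+ J.-1 / 4]; the second does so at the final time, since [lyap z >= 1 / 4]. *)
pose C (k : nat) := 4 / growth l ^+ J.-1 + 4 * expR (- (rate * (t - k%:R * dt))).
have C0 k : 0 <= C k 
  by rewrite addr_ge0 ?divr_ge0 ?mulr_ge0 ?expR_ge0 ?exprn_ge0 ?(ltW mu0).
have nd : nondecreasing_seq (fun i : nat => i%:R * dt).
  by move=> i j ij; rewrite ler_wpM2r ?(ltW dt0)// ler_nat.
have mX i : measurable_fun setT (fun w => Z (i.+1%:R * dt) w - Z (i%:R * dt) w).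
  have m1 := BM_measurable BM (mulr_ge0 (ler0n R i) (ltW dt0)).
  have m2 := BM_measurable BM (mulr_ge0 (ler0n R i.+1) (ltW dt0)).
  apply: measurable_fun_pair => /=; apply: measurable_funB;
  by [exact: measurableT_comp measurable_fst _|exact: measurableT_comp measurable_snd _].
pose nu : subprobability mR R := normal_prob (0 : R) s.
pose Q : {sigma_finite_measure set (mR * mR)%type -> \bar R} :=
  product_subprobability (nu, nu).
have wb := @walk_bound R d T P z0 (fun k w => Z (k%:R * dt) w) Q _ mX _ _
  (in_range x J) (fun u => admissible x b J r u.1 u.2) _ _ N.+1
  (fun k z => lyap z * C k) _ _ _ _ _.
rewrite [X in (_ <= X)%E](_ : _ = (lyap z0 * C 0)%:E); last by rewrite /C mul0r subr0.
apply: wb.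
- by move=> w; rewrite mul0r (BM_start BM).
- move=> n; apply: (BM_independent BM _ nd); by rewrite mul0r.
- move=> i B mB.
  have i0 : 0 <= i%:R * dt by rewrite mulr_ge0// ltW.
  have i1 : i%:R * dt < i.+1%:R * dt by rewrite ltr_pM2r// ltr_nat.
  have := BM_gaussian BM i0 i1 mB.
  by rewrite -mulrBl -natr1 [_ + 1]addrC addrK mul1r.
- exact: measurable_in_range.
- exact: measurable_admissible.
- by move=> k; apply: measurable_funM => //; exact: measurable_lyapunov.
- by move=> k z; rewrite mulr_ge0 ?(ltW (lyapunov_gt0 z)).
- move=> k z zr; rewrite /lyapunov (negbTE zr) /C mulrDr.
  rewrite -[leLHS]addr0 lerD ?mulr_ge0 ?expR_ge0 ?divr_ge0 ?exprn_ge0 ?(ltW mu0)//.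
  by rewrite mulrA divfK// divff// gt_eqF// exprn_gt0.
- move=> z; rewrite /C /dt mulrCA divff// mulr1 subrr mulr0 oppr0 expR0 mulr1.
  have := lyapunov_ge z => zl.
  have : 0 <= 4 / growth l ^+ J.-1 by rewrite divr_ge0 ?exprn_ge0 ?(ltW mu0).
  by move=> q; nra.
- move=> k z kN zr.
  have sr' : 2 * s <= r by [].
  have step := lyapunov_gauss_step s0 sr' zr.
  have mf := measurable_killed_lyapunov z.
  have f0 (h : R * R) : (0 <=
      if admissible x b J r z (z + h)%R then (lyap (z + h)%R)%:E else 0)%E.
    by case: ifP => // _; rewrite lee_fin ltW// lyapunov_gt0.
  apply: (@le_trans _ _ ((lyap z * expR (- (rate * s ^+ 2)))%:E * (C k.+1)%:E)%E).
    apply: le_trans (lee_wpmul2r _ step); last by rewrite lee_fin.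
    rewrite -ge0_integralZr//; last by rewrite lee_fin.
    rewrite le_eqVlt; apply/orP; left; apply/eqP; apply: eq_integral => h _ /=.
    by case: ifP => // _; rewrite ?mul0e// EFinM.
  rewrite -EFinM lee_fin -mulrA ler_wpM2l ?(ltW (lyapunov_gt0 z))// /C s2 mulrDr.
  have e1 : expR (- (rate * dt)) <= 1.
    by rewrite -expR0 ler_expR oppr_le0 mulr_ge0 ?(ltW rate_gt0) ?(ltW dt0).
  rewrite lerD//.
    by rewrite ler_piMl// divr_ge0 ?exprn_ge0 ?(ltW mu0).
  rewrite mulrCA ler_wpM2l// -expRD ler_expR -natr1.
  by rewrite (_ : - (rate * dt) - rate * (t - (k%:R + 1) * dt) =
    - (rate * (t - k%:R * dt)))//; ring.
Qed.

End survival_bound.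

End survival.

(** * Moments of the exit time *)

Section moments.
Context {R : realType} {d : measure_display} {T : measurableType d}.
Variable P : probability T R.

Lemma sum_geometric_le (C rho : R) n : 0 <= C -> 0 <= rho < 1 ->
  \sum_(0 <= i < n) C * rho ^+ i <= C / (1 - rho).
Proof.
move=> C0 /andP[r0 r1].
suff : \sum_(0 <= i < n) C * rho ^+ i = C / (1 - rho) * (1 - rho ^+ n).
  move=> ->; rewrite ler_piMr ?divr_ge0 ?subr_ge0 ?(ltW r1)//.
  by rewrite gerBl exprn_ge0.
elim: n => [|n IH]; first by rewrite big_geq// expr0 subrr mulr0.
rewrite big_nat_recr//= IH exprS; field.
by rewrite subr_eq0 gt_eqF.
Qed.

(* The exit time is not known to be measurable, whence no measurability
   assumption on the smaller function. *)
Lemma ge0_le_integral_majorant (f g : T -> \bar R) :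
  (forall w, 0 <= f w)%E -> (forall w, f w <= g w)%E ->
  (\int[P]_w f w <= \int[P]_w g w)%E.
Proof.
move=> f0 fg; have g0 w : (0 <= g w)%E by exact: le_trans (fg w).
rewrite !ge0_integralTE//; apply: le_ereal_sup => _ [h hf <-].
by exists h => // w; exact: le_trans (hf w) (fg w).
Qed.

(** If [j] is the least index with [w] outside [E j], then [tau w <= t j], and [w] lies in [E i]
    when [j = i.+1]. So the power of [tau] is at most that of [t 0] plus the sum over [i] of that of
    [t i.+1] on [E i], except on the intersection [N] of all the [E i], which is null. *)
Lemma moment_lt_pinfty (tau : T -> \bar R) (t : nat -> R) (E : nat -> set T)
    (p C rho : R) :
  0 < p -> 0 <= C -> 0 <= rho < 1 -> (forall w, 0 <= tau w)%E ->
  (forall i, 0 <= t i) -> (forall i, measurable (E i)) ->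
  (forall i w, ((t i)%:E < tau w)%E -> E i w) ->
  (forall i, (P (E i) <= (C * rho ^+ i)%:E)%E) ->
  (forall i, ((t i.+1 `^ p)%:E * P (E i) <= (C * rho ^+ i)%:E)%E) ->
  (moment P tau p < +oo)%E.
Proof.
move=> p0 C0 hrho tau0 t0 mE tauE PE tPE.
pose N := \bigcap_i E i.
have mN : measurable N by exact: bigcapT_measurable.
have PN : P N = 0%E.
  apply/eqP; rewrite eq_le measure_ge0 andbT.
  apply/lee_addgt0Pr => e e0; rewrite add0e.
  have rho1 : `|rho| < 1 by move: hrho => /andP[r0 r1]; rewrite ger0_norm.
  have /cvgrPdist_le/(_ _ e0)[n _ hn] := cvg_geometric C rho1.
  apply: (@le_trans _ _ (P (E n))).
    by apply: le_measure; rewrite ?inE// => w; exact.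
  apply: le_trans (PE n) _; rewrite lee_fin.
  by have := hn n (leqnn n); rewrite sub0r normrN /geometric/= =>
    /(le_trans (ler_norm _)).
(* The infinite term takes care of the null set [N] and has integral 0. *)
pose g w : \bar R := ((t 0%N `^ p)%:E +
  (\sum_(i <oo) ((t i.+1 `^ p)%:E * (\1_(E i) w)%:E) + +oo * (\1_N w)%:E))%E.
have series0 w i : (0 <= (t i.+1 `^ p)%:E * (\1_(E i) w)%:E)%E.
  by rewrite mule_ge0// lee_fin powR_ge0.
have sum0 w : (0 <= \sum_(i <oo) ((t i.+1 `^ p)%:E * (\1_(E i) w)%:E))%E.
  exact: nneseries_ge0.
have N0 w : (0 <= +oo * (\1_N w)%:E :> \bar R)%E by rewrite mule_ge0// lee_fin.
have taug w : (tau w `^ p <= g w)%E.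
  have [Nw|notN] := pselect (N w).
    rewrite /g indicE mem_set// mule1 [X in (_ + X)%E]addey; last first.
      by rewrite -ltNye (lt_le_trans _ (sum0 w)).
    by rewrite addey ?leey.
  have [i Ei] : exists i, ~~ `[< E i w >].
    by move/existsNP: notN => [i /not_implyP[_ /asboolPn Ei]]; exists i.
  have ex : exists i, ~~ `[< E i w >] by exists i.
  have [j Ej jmin] := ex_minnP ex.
  have tauj : (tau w <= (t j)%:E)%E.
    by rewrite leNgt; apply/negP => /tauE; move/asboolPn: Ej.
  have tj : (tau w `^ p <= (t j `^ p)%:E)%E.
    rewrite -poweR_EFin gt0_ler_poweR ?(ltW p0)// in_itv/= ?leey ?andbT ?tau0//.
    by rewrite lee_fin t0.
  apply: le_trans tj _; rewrite /g; case: j jmin {Ej tauj} => [_|j jmin].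
    by rewrite leeDl// adde_ge0.
  have Ejw : E j w.
    have [//|nE] := pselect (E j w).
    by have := jmin j (introN (asboolP _) nE); rewrite ltnn.
  rewrite addeCA; apply: le_trans (leeDl _ _); last by rewrite adde_ge0// lee_fin powR_ge0.
  apply: le_trans (nneseries_lim_ge j.+1 _) => //.
  rewrite big_nat_recr//= indicE mem_set// mule1 leeDr//.
  exact: sume_ge0.
have mser : measurable_fun setT
    (fun w => (\sum_(i <oo) ((t i.+1 `^ p)%:E * (\1_(E i) w)%:E))%E).
  apply: ge0_emeasurable_sum => // i _.
  by apply/measurable_EFinP; apply: measurable_funM => //; exact: measurable_indic.
have mN1 : measurable_fun setT (fun w => (\1_N w : R)%:E).
  by apply/measurable_EFinP; exact: measurable_indic.
have mooN : measurable_fun setT (fun w => (+oo * (\1_N w : R)%:E)%E).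
  exact: emeasurable_funM.
apply: (@le_lt_trans _ _ (\int[P]_w g w)%E).
  by apply: ge0_le_integral_majorant => // w; exact: poweR_ge0.
rewrite /g ge0_integralD//; last first.
- exact: emeasurable_funD.
- by move=> w _; rewrite adde_ge0.
- by move=> w _; rewrite lee_fin powR_ge0.
have iN : (\int[P]_w (+oo * (\1_N w : R)%:E) = 0)%E.
  rewrite ge0_integralZl// [X in (_ * X)%E](_ : _ = 0%E) ?mule0//.
  by rewrite integral_indic// setIT.
rewrite ge0_integralD// iN adde0.
rewrite integral_cst// lte_add_pinfty//.
  by rewrite [X in (_ * X)%E](_ : _ = 1%E) ?mule1 ?ltry//; exact: probability_setT.
rewrite integral_nneseries//; last first.
  by move=> i; apply/measurable_EFinP; apply: measurable_funM => //; exact: measurable_indic.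
apply: (@le_lt_trans _ _ (C / (1 - rho))%:E); last exact: ltry.
apply: lime_le; first by apply: is_cvg_nneseries => i _ _; exact: integral_ge0.
near=> n; apply: (@le_trans _ _ (\sum_(0 <= i < n) (C * rho ^+ i)%:E)%E).
  apply: lee_sum => i _; rewrite ge0_integralZl_EFin ?powR_ge0//.
    by rewrite integral_indic// setIT.
  by apply/measurable_EFinP; exact: measurable_indic.
by rewrite sumEFin lee_fin sum_geometric_le.
Unshelve. all: by end_near.
Qed.

End moments.

Section exit_tail.
Context {R : realType} (l : R) (x b : int -> R) (J : nat) (r : R).
Hypothesis l0 : 0 < l.
Hypothesis x_mono : {homo x : m n / m < n}.
Hypothesis b_ub : forall n, Num.max (b (n - 1)) (b (n + 1)) <= l * width x n.
Hypothesis r_gt0 : 0 < r.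
Hypothesis r_ub : forall n, (`|n| < J)%N -> r <= width x n / 20.
Context {d : measure_display} {T : measurableType d} (P : probability T R).
Variables (z0 : R * R) (Z : R -> T -> R * R).
Hypothesis BM : standard_planar_BM P z0 Z.

(** Since the fineness required depends on the path, the event is the union over [M] of the paths
    admissible for every subdivision with [N >= M]. These sets [F M] increase, and each lies in some
    [D N] to which [survival_bound] applies; continuity from below gives the bound for the union. *)
Lemma exit_tail (t : R) : 0 < t -> exists E : set T,
  [/\ measurable E,
      (forall w, (t%:E < exit_time Z (comb_domain x b) w)%E -> E w) &
      (P E <= (lyapunov l x J z0 *
        (4 / growth l ^+ J.-1 + 4 * expR (- (rate l x J * t))))%:E)%E].
Proof.
move=> t0.
pose D (N : nat) := [set w | forall k, (k < N.+1)%N ->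
  admissible x b J r (Z (k%:R * (t / N.+1%:R)) w) (Z (k.+1%:R * (t / N.+1%:R)) w)].
have mD N : measurable (D N).
  rewrite (_ : D N = \bigcap_(k in `I_N.+1)
    (fun w => admissible x b J r (Z (k%:R * (t / N.+1%:R)) w)
       (Z (k.+1%:R * (t / N.+1%:R)) w)) @^-1` [set true]); last by apply/seteqP; split.
  apply: bigcap_measurableType => k _.
  have dt0 : 0 <= t / N.+1%:R by rewrite divr_ge0// ltW.
  have m1 := BM_measurable BM (mulr_ge0 (ler0n R k) dt0).
  have m2 := BM_measurable BM (mulr_ge0 (ler0n R k.+1) dt0).
  have m12 := measurableT_comp (measurable_admissible x b J r)
    (measurable_fun_pair m1 m2).
  rewrite -[X in measurable X]setTI; exact: m12.
pose F M := \bigcap_(N in [set N | (M <= N)%N]) D N.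
have mF M : measurable (F M) by exact: bigcap_measurableType.
pose B := (lyapunov l x J z0 * (4 / growth l ^+ J.-1 + 4 * expR (- (rate l x J * t))))%:E.
have [M0 hM0] : exists M0 : nat, forall N, (M0 <= N)%N -> 2 * Num.sqrt (t / N.+1%:R) <= r.
  exists (Num.truncn (t / (r / 2) ^+ 2)) => N M0N.
  have r20 : 0 < r / 2 by rewrite divr_gt0.
  rewrite mulrC -ler_pdivlMr// -(gtr0_norm r20) -sqrtr_sqr ler_sqrt ?sqr_ge0//.
  rewrite ler_pdivrMr// mulrC -ler_pdivrMr ?exprn_gt0//.
  by rewrite (le_trans (ltW (truncnS_gt _)))// ler_nat.
have PF M : (P (F M) <= B)%E.
  pose N := maxn M M0.
  apply: (@le_trans _ _ (P (D N))).
    by apply: le_measure; rewrite ?inE// => w; apply; rewrite /= leq_maxl.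
  apply: (survival_bound l0 x_mono b_ub r_gt0 r_ub BM t0).
  by apply: hM0; rewrite leq_maxr.
exists (\bigcup_M F M); split.
- exact: bigcup_measurable.
- move=> w tw.
  have alive s : 0 <= s <= t -> comb_domain x b (Z s w).
    move=> /andP[s0 st]; apply: contrapT => nD.
    have : (exit_time Z (comb_domain x b) w <= s%:E)%E.
      by apply: ereal_inf_lbound; exists s.
    by move=> /(lt_le_trans tw); rewrite lte_fin ltNge st.
  have [M hM] := surviving_path_admissible J r_gt0 t0
    (@BM_continuous _ _ _ _ _ _ BM w) alive.
  by exists M => // N MN k kN; exact: hM.
- have cv : P \o F @ \oo --> P (\bigcup_M F M).
    apply: nondecreasing_cvg_mu => //; first exact: bigcup_measurable.
    move=> m n mn; apply/subsetPset => w Fw N /= nN; apply: Fw.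
    exact: leq_trans nN.
  rewrite -(cvg_lim _ cv)//; apply: lime_le; first by apply/cvg_ex; eexists; exact: cv.
  by apply: nearW => M /=; exact: PF.
Qed.

End exit_tail.

(** * Gates without accumulation point *)

Section gaps.
Context {R : realType} (x : int -> R).

Lemma isolated_range : limit_point (range x) = set0 ->
  forall L, exists2 e, 0 < e & forall n, x n != L -> e <= `|x n - L|.
Proof.
move=> lp L; apply: contrapT => noe.
suff : limit_point (range x) L by rewrite lp.
move=> U /nbhs_ballP[e /= e0 eU]; apply: contrapT => noy; apply: noe.
exists e => // n nL; rewrite leNgt; apply/negP => nLe; apply: noy.
by exists (x n); split => //; [exists n|apply: eU; rewrite /ball/= distrC].
Qed.

(** A bounded increasing sequence would come arbitrarily close to its supremum without attaining
    it. *)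
Lemma unbounded_above (u : nat -> R) : {homo u : m n / (m < n)%N >-> m < n} ->
  (forall L, exists2 e, 0 < e & forall n, u n != L -> e <= `|u n - L|) ->
  forall y, exists n, y < u n.
Proof.
move=> um iso y; apply: contrapT => /forallNP uy.
have ub n : u n <= y by rewrite leNgt; apply/negP.
have hs : has_sup (range u).
  by split; [exists (u 0%N); exists 0%N|exists y => _ [n _ <-]].
have [e e0 he] := iso (sup (range u)).
have [_ [n _ <-] un] := sup_adherent e0 hs.
have lts : u n < sup (range u).
  apply: lt_le_trans (um _ _ (ltnSn n)) _; apply: ub_le_sup; first by case: hs.
  by exists n.+1.
have := he n; rewrite lt_eqF// => /(_ isT).
by rewrite ltr0_norm ?subr_lt0//; lra.
Qed.

Lemma in_range_large : {homo x : m n / m < n} -> limit_point (range x) = set0 ->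
  forall z, exists J, in_range x J z.
Proof.
move=> xm /isolated_range iso z.
have [m zm] : exists m : nat, z.1 < x m%:Z.
  apply: unbounded_above => [i j ij|L]; first by apply: xm; rewrite ltz_nat.
  by have [e e0 he] := iso L; exists e => // k; exact: he.
have [n zn] : exists n : nat, - z.1 < - x (- n%:Z).
  apply: (unbounded_above (u := fun n : nat => - x (- n%:Z))) => [i j ij|L].
    by rewrite ltrN2 xm// ltrN2 ltz_nat.
  have [e e0 he] := iso (- L); exists e => // k kL.
  rewrite -normrN opprD opprK he//.
  by apply: contraNneq kL => ->; rewrite opprK.
exists (maxn m n); apply/andP; split.
  rewrite ltrN2 in zn; apply: le_lt_trans zn.
  by apply: (ltW_homo xm); rewrite lerN2 lez_nat leq_maxr.
by apply: lt_le_trans zm _; apply: (ltW_homo xm); rewrite lez_nat leq_maxl.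
Qed.

Lemma in_range_leq J J' z : {homo x : m n / m < n} -> (J <= J')%N ->
  in_range x J z -> in_range x J' z.
Proof.
move=> xm JJ' /andP[z1 z2]; apply/andP; split.
  by apply: le_lt_trans z1; apply: (ltW_homo xm); rewrite lerN2 lez_nat.
by apply: lt_le_trans z2 _; apply: (ltW_homo xm); rewrite lez_nat.
Qed.

(** The radius may shrink as [J] grows, since the bound of [exit_tail] does not involve it. *)
Lemma radius_exists (J : nat) : {homo x : m n / m < n} ->
  exists2 r, 0 < r & forall n, (`|n| < J)%N -> r <= width x n / 20.
Proof.
move=> xm; exists (\big[Num.min/1]_(n <- levels J) (width x n / 20)).
  have [->|[n _ ->]] := bigmin_attained (levels J) (fun n => width x n / 20) 1.
    by [].
  by rewrite divr_gt0// width_gt0.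
by move=> n nJ; apply: (bigmin_le_mem (fun n => width x n / 20)); rewrite mem_levels.
Qed.

End gaps.

(** The power of [n] costs [expR (a / 4 * n)], by [y <= expR y], and that of [M] costs
    [expR (a / 2 * n)], by the hypothesis on [S]. The total exponent [3 / 4 * a * n] stays below the
    exponent [a * n] of the survival estimate. *)
Lemma powR_time_bound (R : realType) (a p c S M : R) (n : nat) :
  0 < a -> 0 < p -> 0 <= c -> 0 <= M ->
  M * expR (- (a / 2)) `^ (n%:R / p) <= S ->
  (n%:R * c * M) `^ p <=
  (4 * p / a) `^ p * c `^ p * S `^ p * expR (3 / 4 * a * n%:R).
Proof.
move=> a0 p0 c0 M0 MS.
have n0 : 0 <= n%:R :> R by [].
have pa : 0 < 4 * p / a by rewrite divr_gt0// mulr_gt0.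
have S0 : 0 <= S by apply: le_trans MS; rewrite mulr_ge0// powR_ge0.
have np : n%:R `^ p <= (4 * p / a) `^ p * expR (a / 4 * n%:R).
  have -> : expR (a / 4 * n%:R) = expR (a * n%:R / (4 * p)) `^ p.
    by rewrite -expRM; congr expR; field; rewrite gt_eqF.
  rewrite -powRM ?expR_ge0 ?(ltW pa)//.
  apply: ge0_ler_powR; rewrite ?nnegrE; [exact: ltW|by []| |].
    by rewrite mulr_ge0 ?expR_ge0 ?(ltW pa).
  have e1 : a * n%:R / (4 * p) <= expR (a * n%:R / (4 * p)).
    by apply: le_trans (expR_ge1Dx _); rewrite lerDr.
  have := ler_wpM2l (ltW pa) e1; apply: le_trans.
  by rewrite le_eqVlt; apply/orP; left; apply/eqP; field; rewrite !gt_eqF.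
have Mp : M `^ p <= S `^ p * expR (a / 2 * n%:R).
  have := @ge0_ler_powR _ p (ltW p0) _ _ _ _ MS.
  rewrite !nnegrE mulr_ge0 ?powR_ge0// => /(_ isT S0).
  rewrite powRM ?powR_ge0// -powRrM -expRM.
  have -> : - (a / 2) * (n%:R / p * p) = - (a / 2 * n%:R) by field; rewrite gt_eqF.
  by rewrite expRN ler_pdivrMr ?expR_gt0.
rewrite [(_ * M) `^ p]powRM ?mulr_ge0// [(_ * c) `^ p]powRM//.
have -> : 3 / 4 * a * n%:R = a / 4 * n%:R + a / 2 * n%:R by field.
rewrite expRD.
have := ler_pM (powR_ge0 _ _) (powR_ge0 _ _) np Mp => H.
have := ler_wpM2r (powR_ge0 c p) H.
rewrite [leLHS]mulrAC => /le_trans; apply.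
by rewrite le_eqVlt; apply/orP; left; apply/eqP; ring.
Qed.

Definition decay {R : realType} (l : R) : R := expR (- (ln (growth l) / 2)).

Lemma exit_moment (R : realType) (l : R) (x b : int -> R) (p S : R) :
  0 < l -> {homo x : m n / m < n} -> limit_point (range x) = set0 ->
  (forall n, Num.max (b (n - 1)) (b (n + 1)) <= l * width x n) ->
  0 < p ->
  (forall j, (0 < j)%N -> max_gap_sq x j * decay l `^ (j%:R / p) <= S) ->
  finite_exit_moment (comb_domain x b) p.
Proof.
move=> l0 xm lp b_ub p0 MS d T P z Z _ BM.
have mu1 : 1 < growth l by exact: growth_gt1.
have mu0 : 0 < growth l by rewrite (lt_trans ltr01).
set a := ln (growth l); have a0 : 0 < a by rewrite ln_gt0.
have muE n : growth l ^+ n = expR (n%:R * a) by rewrite expRM_natl lnK.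
have [J1 zJ1] := in_range_large xm lp z.
have [n0 n0J n0z] := in_rangeP xm zJ1.
pose J i := (J1 + i).+1.
have zJ i : in_range x (J i) z by apply: in_range_leq zJ1 => //; rewrite /J; lia.
have M0 i : 0 < max_gap_sq x i by exact: max_gap_sq_gt0.
have rate0 i : 0 < rate l x i by exact: rate_gt0.
(* At this time the exponential term of [exit_tail] is [growth l] to the power [- J i], comparable
   to the other term. *)
pose t i := (J i)%:R * a / rate l x (J i).
have t0 i : 0 < t i by rewrite divr_gt0// mulr_gt0// ltr0n.
(* The gate [n0] is fixed by the starting point, so this bound on the initial Lyapunov value is
   uniform in [i]. *)
pose V0 := growth l ^+ `|n0|.
have V00 : 0 < V0 by rewrite exprn_gt0.
have tails i : exists Ei : set T, [/\ measurable Ei,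
    (forall w, ((t i)%:E < exit_time Z (comb_domain x b) w)%E -> Ei w) &
    (P Ei <= (8 * V0 * expR (- (a * i%:R)))%:E)%E].
  have [r r0 r_ub] := radius_exists (J i) xm.
  have [Ei [mE tE PE]] := exit_tail l0 xm b_ub r0 r_ub BM (t0 i).
  exists Ei; split => //; apply: le_trans PE _; rewrite lee_fin.
  have Vle : lyapunov l x (J i) z <= V0.
    by apply: lyapunov_le => //; rewrite /J; lia.
  have iJ : a * i%:R <= (J1 + i)%:R * a.
    by rewrite mulrC ler_wpM2r ?(ltW a0)// ler_nat leq_addl.
  rewrite (_ : 8 * V0 * _ = V0 * (8 * expR (- (a * i%:R)))); last by ring.
  apply: ler_pM => //.
  - by rewrite ltW// (lyapunov_gt0 l0 xm b_ub r0 r_ub).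
  - by rewrite addr_ge0 ?divr_ge0 ?mulr_ge0 ?expR_ge0 ?exprn_ge0 ?(ltW mu0).
  - rewrite /J /= muE -expRN /t mulrCA divff ?gt_eqF// mulr1.
    have q1 : expR (- ((J1 + i)%:R * a)) <= expR (- (a * i%:R)).
      by rewrite ler_expR lerN2.
    have q2 : expR (- ((J i)%:R * a)) <= expR (- (a * i%:R)).
      rewrite ler_expR lerN2 (le_trans iJ)// ler_wpM2r ?(ltW a0)// ler_nat.
      exact: leqnSn.
    lra.
pose E i := sval (cid (tails i)).
have hE i := svalP (cid (tails i)).
have lk0 : 0 < leak l by exact: leak_gt0.
have gm0 : 0 < gauss_mass :> R by exact: gauss_mass_gt0.
pose c := a * (2 / (leak l * gauss_mass ^+ 2)).
have c0 : 0 <= c by rewrite ltW// mulr_gt0// divr_gt0// mulr_gt0// exprn_gt0.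
have tE i : t i = (J i)%:R * c * max_gap_sq x (J i).
  by rewrite /t /rate /c; field; rewrite !gt_eqF.
pose C1 := (4 * p / a) `^ p * c `^ p * S `^ p.
have C10 : 0 <= C1 by rewrite !mulr_ge0 ?powR_ge0.
pose C2 := C1 * expR (3 / 4 * a * (J1.+2)%:R).
have C20 : 0 <= C2 by rewrite mulr_ge0 ?expR_ge0.
have rhoE i : expR (- (a / 4)) ^+ i = expR (i%:R * - (a / 4)) by rewrite expRM_natl.
have V80 : 0 <= 8 * V0 by rewrite mulr_ge0// ltW.
(* The ratio [expR (- (a / 4))] is what the factor [expR (3 / 4 * a * i)] leaves of the decay
   [expR (- (a * i))]. The [+ 1] in the constant serves the bound on the probabilities alone. *)
apply: (@moment_lt_pinfty _ _ _ P _ t E p ((C2 + 1) * (8 * V0)) (expR (- (a / 4)))) => //.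
- by rewrite mulr_ge0// addr_ge0.
- by rewrite expR_ge0 expR_lt1 oppr_lt0 divr_gt0.
- move=> w; rewrite /exit_time; apply: le_ereal_inf_tmp => _ [s [s0 _] <-].
  by rewrite lee_fin.
- by move=> i; rewrite ltW.
- by move=> i; have [] := hE i.
- by move=> i; have [] := hE i.
- move=> i; have [_ _ PE] := hE i; apply: le_trans PE _; rewrite lee_fin.
  rewrite [leRHS]mulrAC [leRHS]mulrC -[leLHS]mulr1 -[leLHS]mulrA ler_wpM2l//.
  rewrite mulr1 rhoE -[leLHS]mul1r ler_pM ?expR_ge0//; first by rewrite lerDr.
  by rewrite ler_expR; have := ler0n R i; nra.
- move=> i; have [_ _ PE] := hE i.
  have tp : t i.+1 `^ p <= C1 * expR (3 / 4 * a * (J i.+1)%:R).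
    rewrite tE; apply: powR_time_bound => //; first exact: ltW.
    exact: MS.
  apply: (@le_trans _ _ ((C1 * expR (3 / 4 * a * (J i.+1)%:R))%:E *
      (8 * V0 * expR (- (a * i%:R)))%:E)%E).
    by rewrite lee_pmul ?lee_fin ?powR_ge0.
  rewrite -EFinM lee_fin rhoE.
  have -> : expR (3 / 4 * a * (J i.+1)%:R) =
      expR (3 / 4 * a * (J1.+2)%:R) * expR (3 / 4 * a * i%:R).
    rewrite -expRD -mulrDr -natrD; congr (expR (_ * _%:R)).
    by rewrite /J addnS addSnnS addnS.
  have -> : expR (i%:R * - (a / 4)) = expR (3 / 4 * a * i%:R) * expR (- (a * i%:R)).
    by rewrite -expRD; congr expR; field.
  rewrite [leLHS](_ : _ = C2 * (8 * V0) *
    (expR (3 / 4 * a * i%:R) * expR (- (a * i%:R)))); last by rewrite /C2; ring.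
  rewrite ler_wpM2r ?mulr_ge0 ?expR_ge0// ler_wpM2r// lerDl//.
Qed.

Theorem theorem4 (R : realType) (l : R) (hl : 0 < l) :
  exists theta0 : R, 0 < theta0 < 1 /\
  forall x b : int -> R,
    {homo x : m n / m < n} ->
    limit_point (range x) = set0 ->
    x 0 = 0 ->
    (forall n, 0 < b n) ->
    ereal_sup (range (fun n : int => (gap_ratio x b n)%:E)) = l%:E ->
    forall p : R, 0 < p ->
      (\sum_(1 <= j <oo)
          (max_gap_sq x j * theta0 `^ (j%:R / p))%:E < +oo)%E ->
      finite_exit_moment (comb_domain x b) p.
Proof.
have a0 : 0 < ln (growth l) by rewrite ln_gt0// growth_gt1.
exists (decay l); split.
  by rewrite expR_gt0 expR_lt1 oppr_lt0 divr_gt0.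
move=> x b xm lp _ _ ratio p p0 fin.
have b_ub n : Num.max (b (n - 1)) (b (n + 1)) <= l * width x n.
  rewrite -ler_pdivrMr ?width_gt0// -lee_fin -ratio.
  by apply: ereal_sup_ubound; exists n.
have M0 j : 0 <= max_gap_sq x j by rewrite ltW// max_gap_sq_gt0.
have u0 j : (0 <= (max_gap_sq x j * decay l `^ (j%:R / p))%:E)%E.
  by rewrite lee_fin mulr_ge0// powR_ge0.
apply: (@exit_moment R l x b p
  (fine (\sum_(1 <= j <oo) (max_gap_sq x j * decay l `^ (j%:R / p))%:E)%E)) => //.
(* The terms being non-negative, each is at most the finite sum of the series, seen through the
   partial sum up to [j.+1] excluded. *)
move=> j j0; rewrite -lee_fin fineK; last first.
  by rewrite ge0_fin_numE//; exact: nneseries_ge0.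
apply: le_trans (nneseries_lim_ge j.+1 _) => //.
by rewrite big_nat_recr//= leeDr// sume_ge0.
Qed.
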